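(* Let $\mathcal M$ be a $\mathcal{C}^{(3)}$-smooth embedded submanifold of $\mathbb{R}^n$, $C\subseteq\mathcal M$ and $\bar x\in C$. If $C$ is amenable at $\bar x$ in $\mathcal M$, then $C$ is smoothly approximately convex at $\bar x$ in $\mathcal M$.
   Context: $d_{\mathcal M}$ is the Riemannian (intrinsic) distance on $\mathcal M$. Amenable in $\mathcal M$: there are an open neighborhood $V$ of $\bar x$ in $\mathcal M$, a $\mathcal{C}^{(1)}$ map $F:V\to\mathbb{R}^m$ and a closed convex $D\subseteq\mathbb{R}^m$ with $C\cap V=\{x\in V:F(x)\in D\}$ such that the only $y\in N_D(F(\bar x))=\{y:\langle y,d-F(\bar x)\rangle\le0\ \forall d\in D\}$ with $y\perp\mathrm{Range}(dF(\bar x))$ is $y=0$, where $dF(\bar x):T_{\mathcal M}(\bar x)\to\mathbb{R}^m$ is the differential. An averaging map from $x$ to $x'$ is a curve $g:[0,1]\to\mathcal M$, $g(0)=x,g(1)=x'$, with $d_{\mathcal M}(g(t_1),g(t_2))=|t_1-t_2|d_{\mathcal M}(x,x')$; near $\bar x$ it exists and is unique. A smooth curve segment in $C$ is a curve $\gamma:[0,1]\to C$ extending to a $\mathcal{C}^{(1)}$ map on an open neighborhood of $[0,1]$. Smoothly approximately convex at $\bar x$ in $\mathcal M$: for every $\epsilon>0$ there is a neighborhood $W$ of $\bar x$ such that any distinct $x,x'\in C\cap W$ are joined by a smooth curve segment $\gamma$ in $C$ from $x$ to $x'$ with $\|\gamma'(t)-g'(t)\|\le\epsilon\, d_{\mathcal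 M}(x,x')$ for all $t\in[0,1]$, $g$ the averaging map from $x$ to $x'$. *)

(* Defs.v *)
From HB Require Import structures.
From mathcomp Require Import all_boot all_order all_algebra.
From mathcomp Require Import all_classical all_reals all_analysis.
Set Implicit Arguments. Unset Strict Implicit. Unset Printing Implicit Defensive.
Import Order.TTheory GRing.Theory Num.Theory.
Import numFieldNormedType.Exports.
Local Open Scope classical_set_scope.
Local Open Scope ring_scope.

Section Defs.
Variable R : realType.

(* Euclidean inner product and norm on R^n (the library norm on 'rV is the max norm) *)
Definition dotv (n : nat) (u v : 'rV[R]_n) : R := \sum_(i < n) u ord0 i * v ord0 i.
Definition enorm (n : nat) (v : 'rV[R]_n) : R := Num.sqrt (dotv v v).

Fixpoint Ck (V W : normedModType R) (k : nat) (U : set V) (f : V -> W) : Prop :=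
  match k with
  | 0 => forall x, U x -> {for x, continuous f}
  | k'.+1 => (forall x, U x -> {for x, continuous f}) /\
             forall v : V, (forall x, U x -> derivable f x v) /\ Ck k' U ('D_v f)
  end.

Definition Rint01 : set R := [set t | 0 <= t <= 1].

Definition embedded_submanifold3 (n : nat) (M : set 'rV[R]_n) : Prop :=
  forall p, M p -> exists (k : nat) (U : set 'rV[R]_n) (Phi : 'rV[R]_n -> 'rV[R]_k),
    [/\ open U, U p, Ck 3 U Phi,
        (forall w : 'rV[R]_k, exists v : 'rV[R]_n, 'D_v Phi p = w) &
        (forall x, U x -> (M x <-> Phi x = 0))].

Definition tangent_space (n : nat) (M : set 'rV[R]_n) (p : 'rV[R]_n) : set 'rV[R]_n :=
  [set v | exists (gam : R -> 'rV[R]_n) (O : set R),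
     open O /\ O 0 /\ Ck 1 O gam /\ gam 0 = p /\
         (\forall t \near (0 : R), M (gam t)) /\ 'D_1 gam 0 = v].

Definition C1_curve_in (n : nat) (S : set 'rV[R]_n) (x y : 'rV[R]_n)
  (gam : R -> 'rV[R]_n) : Prop :=
  exists O : set R, open O /\ Rint01 `<=` O /\ Ck 1 O gam /\
     (forall t, Rint01 t -> S (gam t)) /\ gam 0 = x /\ gam 1 = y.

Definition curve_length (n : nat) (gam : R -> 'rV[R]_n) : \bar R :=
  (\int[@lebesgue_measure R]_(t in `[0%R, 1%R]) (enorm ('D_1 gam t))%:E)%E.

Definition dM (n : nat) (M : set 'rV[R]_n) (x y : 'rV[R]_n) : \bar R :=
  ereal_inf [set L | exists gam, C1_curve_in M x y gam /\ L = curve_length gam].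

(* averaging map from x to x' (only its values on [0,1] matter) *)
Definition averaging_map (n : nat) (M : set 'rV[R]_n) (x x' : 'rV[R]_n)
  (g : R -> 'rV[R]_n) : Prop :=
  [/\ (forall t, Rint01 t -> M (g t)), g 0 = x, g 1 = x' &
      forall t1 t2, Rint01 t1 -> Rint01 t2 ->
        dM M (g t1) (g t2) = ((`|t1 - t2|)%:E * dM M x x')%E].

Definition has_deriv01 (n : nat) (g : R -> 'rV[R]_n) (t : R) (w : 'rV[R]_n) : Prop :=
  (fun h : R => h^-1 *: (g (t + h) - g t))
    @ within [set h : R | h != 0 /\ Rint01 (t + h)] (nbhs (0 : R)) --> w.

Definition convex_set_in (m : nat) (D : set 'rV[R]_m) : Prop :=
  forall a b (t : R), D a -> D b -> 0 <= t <= 1 -> D ((1 - t) *: a + t *: b).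

Definition normal_cone (m : nat) (D : set 'rV[R]_m) (z : 'rV[R]_m) : set 'rV[R]_m :=
  [set y | forall d, D d -> dotv y (d - z) <= 0].

(* amenable at xb in M; the C^1 map F on the M-neighbourhood V = M ∩ O is given
   by a C^1 map on the open set O of R^n *)
Definition amenable_in (n : nat) (M C : set 'rV[R]_n) (xb : 'rV[R]_n) : Prop :=
  exists (m : nat) (O : set 'rV[R]_n) (F : 'rV[R]_n -> 'rV[R]_m) (D : set 'rV[R]_m),
    open O /\ O xb /\ Ck 1 O F /\ closed D /\ convex_set_in D /\
        (forall x, M x -> O x -> (C x <-> D (F x))) /\
        (forall y, normal_cone D (F xb) y ->
           (forall v, tangent_space M xb v -> dotv y ('D_v F xb) = 0) -> y = 0).

Definition smooth_curve_segment (n : nat) (C : set 'rV[R]_n) (x x' : 'rV[R]_n)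
  (gam : R -> 'rV[R]_n) : Prop := C1_curve_in C x x' gam.

Definition smoothly_approx_convex (n : nat) (M C : set 'rV[R]_n) (xb : 'rV[R]_n) : Prop :=
  forall eps : R, 0 < eps -> exists W : set 'rV[R]_n, nbhs xb W /\
    forall x x', C x -> C x' -> W x -> W x' -> x != x' ->
      exists gam, smooth_curve_segment C x x' gam /\
        forall g, averaging_map M x x' g ->
          forall t, Rint01 t -> forall w, has_deriv01 g t w ->
            ((enorm ('D_1 gam t - w))%:E <= eps%:E * dM M x x')%E.

End Defs.

(* Main.v *)
Require Import Defs.
From mathcomp Require Import all_boot all_order all_algebra.
From mathcomp Require Import all_classical all_reals all_analysis.
From mathcomp Require Import ring lra.
Set Implicit Arguments.
Unset Strict Implicit.
Unset Printing Implicit Defensive.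
Import Order.TTheory GRing.Theory Num.Theory.
Import numFieldNormedType.Exports.
Local Open Scope classical_set_scope.
Local Open Scope ring_scope.

(** Near [xb] the manifold is [Phi = 0], so that [C] is the preimage of the convex
    set [{0} x D] under [G = (Phi, F)], and the constraint qualification says that
    the cone [Range G'(xb) - cone ({0} x D - G xb)] is dense.  Choose elements
    [e_j = u_j G'(xb) - tau_j (d_j - G xb)] of this cone close to the vectors of a
    positive basis of the target space.  Along the chord from [x] to [x'], look for
    [gam t = x + t (x' - x) + sum_j l_j(t) u_j] with
    [G (gam t) = y + sum_j l_j(t) tau_j (d_j - y)], [y = (1 - t) G x + t G x'], whose
    right-hand side is in the convex set as soon as [l >= 0] is small.  Perturbing [l]
    around a positive bump [eps |x' - x| t (1 - t)], the implicit function theorem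
    solves this equation with [l] of class C^1 and [gam' - (x' - x)] small.

    It remains to see that every derivative of an averaging map [g] from [x] to [x']
    is close to [x' - x].  No geodesic equation is needed: as [M] is C^2, chords
    satisfy [dM <= |h| + K |h|^2], so by the parallelogram law the slopes of [g] on
    the two halves of an interval of length [l] differ from the slope on the interval
    by [O (L sqrt (K l L))], where [L = dM x x']; this is summable over the dyadic
    intervals shrinking to a point. *)

(** The obstacle is the condition [l >= 0] near [t = 0] and [t = 1]: the curve has to start at [x]
    and end at [x'], where the construction has [l = 0], and a correction known only to be small
    against [|x' - x|] could make [l] negative there. What saves the argument is that the residual
    along the chord is small against [|x' - x| * (t * (1 - t))], because strict differentiability
    bounds it linearly from each end. A bump of the same profile, with a small but fixed factor,
    then dominates the correction. The bump itself hardly disturbs the equation, since the vectors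
    of the positive basis sum to zero. Density of the cone is enough because Newton steps tolerate
    an approximate right inverse of the derivative. The equation is posed in the variables
    [(x, l, y)]: both ends of the lifted chord are then zeros of one fixed map, and a single radius
    serves all pairs [x], [x']. *)

(** * Row vectors and matrices in the max norm *)

Section MaxNorm.
Variable R : realType.

Lemma rv_norm_le n (v : 'rV[R]_n) (e : R) :
  0 <= e -> (forall i, `|v ord0 i| <= e) -> `|v| <= e.
Proof.
move=> e0 h; rewrite /Num.Def.normr/= mx_normrE (bigmax_le _ e0)//= => -[i j] _.
by rewrite ord1.
Qed.

Lemma le_rv_norm n (v : 'rV[R]_n) i : `|v ord0 i| <= `|v|.
Proof.
rewrite [leRHS]/Num.Def.normr/= mx_normrE.
exact: (le_bigmax _ (fun ij : 'I_1 * 'I_n => `|v ij.1 ij.2|) (ord0, i)).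
Qed.

Lemma mulmx_bounded n m (A : 'M[R]_(n, m)) :
  exists2 K : R, 0 < K & forall v : 'rV_n, `|v *m A| <= K * `|v|.
Proof.
exists (1 + \sum_i \sum_j `|A i j|).
  by rewrite ltr_pwDl// sumr_ge0// => i _; rewrite sumr_ge0.
move=> v; apply: rv_norm_le => [|j].
  by rewrite mulr_ge0// addr_ge0// sumr_ge0// => i _; rewrite sumr_ge0.
rewrite mxE (le_trans (ler_norm_sum _ _ _))// mulrDl mul1r ler_wpDl//.
rewrite mulr_suml ler_sum// => i _.
rewrite normrM mulrC ler_pM// ?le_rv_norm//.
by rewrite (bigD1 j)//= lerDl sumr_ge0.
Qed.

Lemma row_mx_norm_le n m (u : 'rV[R]_n) (v : 'rV[R]_m) e :
  `|u| <= e -> `|v| <= e -> `|row_mx u v| <= e.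
Proof.
move=> ue ve; apply: rv_norm_le => [|i]; first exact: le_trans ue.
by rewrite mxE; case: splitP => j _; apply: le_trans (le_rv_norm _ _) _.
Qed.

Lemma lsubmx_norm_le n m (w : 'rV[R]_(n + m)) : `|lsubmx w| <= `|w|.
Proof. by apply: rv_norm_le => // i; rewrite mxE le_rv_norm. Qed.

Lemma rsubmx_norm_le n m (w : 'rV[R]_(n + m)) : `|rsubmx w| <= `|w|.
Proof. by apply: rv_norm_le => // i; rewrite mxE le_rv_norm. Qed.

End MaxNorm.

(** * Strict differentiability and its relation to C^1 *)

Section StrictDifferentiability.
Variable R : realType.

(** The two points vary independently around [p], unlike in Fréchet differentiability. This
    uniformity makes approximate Newton steps contract and, at all points of an open set, encodes
    C^1 without mentioning continuity of the derivative. *)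
Definition sdiff (n m : nat) (f : 'rV[R]_n -> 'rV[R]_m) (A : 'M[R]_(n, m))
    (p : 'rV[R]_n) : Prop :=
  forall e : R, 0 < e -> exists2 d : R, 0 < d & forall y z,
    `|y - p| < d -> `|z - p| < d -> `|f z - f y - (z - y) *m A| <= e * `|z - y|.

Definition sdiff1 (m : nat) (c : R -> 'rV[R]_m) (v : 'rV[R]_m) (t : R) : Prop :=
  forall e : R, 0 < e -> exists2 d : R, 0 < d & forall y z,
    `|y - t| < d -> `|z - t| < d -> `|c z - c y - (z - y) *: v| <= e * `|z - y|.

Definition jac (n m : nat) (f : 'rV[R]_n -> 'rV[R]_m) (p : 'rV[R]_n) : 'M[R]_(n, m) :=
  \matrix_(i, j) 'D_(delta_mx ord0 i) f p ord0 j.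

(** The scalar mean value theorem is applied to each coordinate of the value; in the max norm
    nothing is lost when the coordinates are collected. *)
Lemma coord_step_pos n m (f : 'rV[R]_n -> 'rV[R]_m) (v : 'rV[R]_n) w q h e :
  0 < h ->
  (forall t, 0 <= t <= h -> derivable f (q + t *: v) v /\
     `|'D_v f (q + t *: v) - w| <= e) ->
  `|f (q + h *: v) - f q - h *: w| <= e * h.
Proof.
move=> h0 H.
have e0 : 0 <= e.
  by have [|_] := H 0; [rewrite lexx ltW|apply: le_trans].
apply: rv_norm_le => [|k]; first by rewrite mulr_ge0// ltW.
pose phi t := f (q + t *: v) ord0 k.
have shiftE t s : q + (s *: 1 + t) *: v = s *: v + (q + t *: v).
  by apply/rowP => i; rewrite !mxE /=; rewrite /GRing.scale/=; ring.
have dphi t : 0 <= t <= h -> is_derive t 1 phi ('D_v f (q + t *: v) ord0 k).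
  move=> /H[df _].
  have /derivable_mxP/(_ ord0 k) := df; rewrite /derivable/= => df1.
  have E : (fun s : R => s^-1 *: (f (s *: v + (q + t *: v)) ord0 k - f (q + t *: v) ord0 k))
     = (fun s : R => s^-1 *: ((phi \o shift t) (s *: 1) - phi t)).
    by apply/funext => s; rewrite /= /phi -shiftE.
  rewrite (derive_mx df) mxE; apply: DeriveDef.
    by rewrite /derivable -E.
  by rewrite /derive -E.
have [|t|c + cE] := @MVT R phi (fun t => 'D_v f (q + t *: v) ord0 k) 0 h h0.
- move=> x /[!in_itv]/= /andP[x0 xh]; apply: dphi.
  by rewrite !ltW.
- apply: continuous_in_subspaceT => x /[!inE]/=; rewrite in_itv/= => xh.
  apply/differentiable_continuous/derivable1_diffP.
  by have [] := dphi _ xh.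
rewrite in_itv/= => /andP[c0 ch].
have [|_] := H c; first by rewrite !ltW.
move=> /(le_trans (le_rv_norm _ k)); rewrite !mxE => Hc.
move: cE; rewrite /phi scale0r addr0 subr0 => ->.
rewrite [_ * h]mulrC -mulrBr normrM mulrC ler_pM//.
by rewrite ger0_norm// ltW.
Qed.

Lemma coord_step n m (f : 'rV[R]_n -> 'rV[R]_m) (A : 'M[R]_(n, m)) q r e :
  (forall z, `|z - q| <= r -> forall i : 'I_n, derivable f z (delta_mx ord0 i) /\
     `|'D_(delta_mx ord0 i) f z - row i A| <= e) ->
  forall y i h, `|y - q| <= r -> `|y + h *: delta_mx ord0 i - q| <= r ->
   `|f (y + h *: delta_mx ord0 i) - f y - h *: row i A| <= e * `|h|.
Proof.
move=> H; have box y h i : `|y - q| <= r -> `|y + h *: delta_mx ord0 i - q| <= r ->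
    forall t, 0 <= t <= 1 -> `|y + (t * h) *: delta_mx ord0 i - q| <= r.
  move=> y1 y2 t /andP[t0 t1].
  have -> : y + (t * h) *: delta_mx ord0 i - q =
      (1 - t) *: (y - q) + t *: (y + h *: delta_mx ord0 i - q).
    by apply/rowP => j; rewrite !mxE; ring.
  rewrite (le_trans (ler_normD _ _))// !normrZ (ger0_norm t0) ger0_norm ?subr_ge0//.
  have -> : r = (1 - t) * r + t * r by ring.
  by rewrite lerD// ler_wpM2l// subr_ge0.
have pos y i h : 0 < h -> `|y - q| <= r -> `|y + h *: delta_mx ord0 i - q| <= r ->
   `|f (y + h *: delta_mx ord0 i) - f y - h *: row i A| <= e * h.
  move=> h0 y1 y2; apply: coord_step_pos => // t /andP[t0 th]; apply: H.
  rewrite -[t](divfK (lt0r_neq0 h0)); apply: box => //.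
  by rewrite divr_ge0//=; [rewrite ler_pdivrMr// mul1r|exact: ltW].
move=> y i h y1 y2; have [h0|h0|->] := ltgtP h 0.
- have := pos (y + h *: delta_mx ord0 i) i (- h).
  rewrite scaleNr addrK oppr_gt0 ltr0_norm// => /(_ h0 y2 y1); apply: le_trans.
  rewrite le_eqVlt; apply/orP; left; rewrite -normrN scaleNr opprK; apply/eqP; congr (`|_|).
  by apply/rowP => j; rewrite !mxE; ring.
- by rewrite (gtr0_norm h0); apply: pos.
- by rewrite !scale0r addr0 !subrr !normr0 mulr0.
Qed.

(** Going from [y] to [z] one coordinate at a time costs the factor [n]. The intermediate points
    stay in the ball because it is a box for the max norm. *)
Lemma coord_mvt n m (f : 'rV[R]_n -> 'rV[R]_m) (A : 'M[R]_(n, m)) q r e : 0 <= e ->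
  (forall z, `|z - q| <= r -> forall i : 'I_n, derivable f z (delta_mx ord0 i) /\
     `|'D_(delta_mx ord0 i) f z - row i A| <= e) ->
  forall y z, `|y - q| <= r -> `|z - q| <= r ->
   `|f z - f y - (z - y) *m A| <= n%:R * e * `|z - y|.
Proof.
move=> e0 H y z yq zq.
pose w (k : nat) : 'rV[R]_n := \row_j (if (j < k)%N then z ord0 j else y ord0 j).
have w0 : w 0%N = y by apply/rowP => j; rewrite mxE.
have wn : w n = z by apply/rowP => j; rewrite mxE ltn_ord.
have r0 : 0 <= r by apply: le_trans yq.
have wr k : `|w k - q| <= r.
  apply: rv_norm_le => // j; rewrite !mxE.
  by case: ifP => _; [move: zq|move: yq] => /(le_trans (le_rv_norm _ j)); rewrite !mxE.
have wS k (kn : (k < n)%N) : w k.+1 =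
    w k + (z - y) ord0 (Ordinal kn) *: delta_mx ord0 (Ordinal kn).
  apply/rowP => j; rewrite !mxE ltnS leq_eqVlt eqxx/=.
  have [jk|] := eqVneq j (Ordinal kn).
    by rewrite jk /= eqxx ltnn mulr1/= addrC subrK.
  rewrite -val_eqE /= => /negbTE ->; rewrite mulr0 addr0//.
suff : forall k, (k <= n)%N -> `|f (w k) - f y - (w k - y) *m A| <= k%:R * e * `|z - y|.
  by move=> /(_ n (leqnn n)); rewrite wn.
elim=> [_|k IH kn]; first by rewrite w0 !subrr mul0mx subrr normr0 !mul0r.
have := wr k.+1; rewrite wS => wr'.
have S1 := coord_step H (wr k) wr'.
set h := (z - y) ord0 _; set d := delta_mx _ _.
have -> : f (w k + h *: d) - f y - (w k + h *: d - y) *m A =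
   (f (w k + h *: d) - f (w k) - h *: row (Ordinal kn) A) +
   (f (w k) - f y - (w k - y) *m A).
  rewrite [w k + _ - y]addrAC (mulmxDl (w k - y)) -scalemxAl -rowE.
  by move: (_ *m _) => B; apply/rowP => j; rewrite !mxE; ring.
rewrite (le_trans (ler_normD _ _))// mulrSr !mulrDl mul1r [leRHS]addrC lerD//; last first.
  by apply: IH; exact: ltnW.
by apply: (le_trans S1); rewrite ler_wpM2l// le_rv_norm.
Qed.

Lemma Ck1_sdiff n m (U : set 'rV[R]_n) (f : 'rV[R]_n -> 'rV[R]_m) p :
  open U -> Ck 1 U f -> U p -> sdiff f (jac f p) p.
Proof.
move=> oU [_ dU] Up e e0.
(* [coord_mvt] multiplies the error by [n]; [n.+1] also covers [n = 0]. *)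
have e1 : 0 < e / n.+1%:R by rewrite divr_gt0.
have : \forall z \near p, U z /\ forall i : 'I_n, `|'D_(delta_mx ord0 i) f p - 'D_(delta_mx ord0 i) f z| <= e / n.+1%:R.
  apply: filterI; first exact: open_nbhs_nbhs.
  apply: (@filter_forall _ _ (fun (i : 'I_n) z => `|'D_(delta_mx ord0 i) f p -
    'D_(delta_mx ord0 i) f z| <= e / n.+1%:R) (nbhs p) _) => i.
  have [_ c] := dU (delta_mx ord0 i); have /cvgrPdist_le := c _ Up.
  by apply.
move=> /nbhs_normP[d /= d0 Hd].
exists (d / 2) => [|y z yp zp]; first by rewrite divr_gt0.
apply: (@le_trans _ _ (n%:R * (e / n.+1%:R) * `|z - y|)).
  apply: (@coord_mvt _ _ _ _ p (d / 2)) => //; [exact: ltW| |exact: ltW|exact: ltW].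
  move=> x xp i; have [|Ux /(_ i) Dx] := Hd x.
    rewrite /= distrC (le_lt_trans xp)// ltr_pdivrMr// ltr_pMr//.
    by rewrite (_ : 1 = 1%:R)// ltr_nat.
  split; first by have [+ _] := dU (delta_mx ord0 i); apply.
  rewrite distrC.
  by have -> : row i (jac f p) = 'D_(delta_mx ord0 i) f p by apply/rowP => j; rewrite !mxE.
rewrite ler_wpM2r// mulrCA -[leRHS]mulr1 ler_pM2l// ler_pdivrMr// mul1r ler_nat//.
Qed.

Lemma sdiff_is_derive n m (f : 'rV[R]_n -> 'rV[R]_m) A p v :
  sdiff f A p -> is_derive p v f (v *m A).
Proof.
move=> fA.
have H : (fun h : R => h^-1 *: ((f \o shift p) (h *: v) - f p)) @ 0^' --> v *m A.
  apply/cvgrPdist_le => e e0.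
  have e1 : 0 < e / (1 + `|v|) by rewrite divr_gt0// ltr_pwDl.
  have [d d0 Hd] := fA _ e1.
  near=> h; have h0 : h != 0 by near: h; exact: nbhs_dnbhs_neq.
  have hd : `|h| * (1 + `|v|) < d.
    rewrite -ltr_pdivlMr ?ltr_pwDl//; near: h; apply: dnbhs0_lt.
    by rewrite divr_gt0// ltr_pwDl.
  have := Hd p (h *: v + p); rewrite subrr normr0 addrK normrZ => /(_ d0).
  have hv : `|h| * `|v| <= `|h| * (1 + `|v|) by rewrite ler_wpM2l// lerDr.
  move=> /(_ (le_lt_trans hv hd)) E.
  have -> : v *m A - h^-1 *: ((f \o shift p) (h *: v) - f p) =
      - h^-1 *: (f (h *: v + p) - f p - (h *: v) *m A).
    rewrite /= -scalemxAl; move: (v *m A) => B.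
    by apply/rowP => i; rewrite !mxE; field.
  rewrite normrZ normrN normfV mulrC ler_pdivrMr ?normr_gt0//.
  apply: (le_trans E).
  have -> : e / (1 + `|v|) * (`|h| * `|v|) = e * `|h| * (`|v| / (1 + `|v|)) by ring.
  rewrite ler_piMr ?mulr_ge0//; first exact: ltW.
  by rewrite ler_pdivrMr ?ltr_pwDl// mul1r lerDr.
by apply: DeriveDef; [apply/cvg_ex; exists (v *m A)|exact: cvg_lim].
Unshelve. all: by end_near. Qed.

Lemma sdiff1_is_derive m (c : R -> 'rV[R]_m) v t (a : R) :
  sdiff1 c v t -> is_derive t a c (a *: v).
Proof.
move=> cv.
have H : (fun h : R => h^-1 *: ((c \o shift t) (h *: a) - c t)) @ 0^' --> a *: v.
  apply/cvgrPdist_le => e e0.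
  have e1 : 0 < e / (1 + `|a|) by rewrite divr_gt0// ltr_pwDl.
  have [d d0 Hd] := cv _ e1.
  near=> h; have h0 : h != 0 by near: h; exact: nbhs_dnbhs_neq.
  have hd : `|h| * (1 + `|a|) < d.
    rewrite -ltr_pdivlMr ?ltr_pwDl//; near: h; apply: dnbhs0_lt.
    by rewrite divr_gt0// ltr_pwDl.
  have := Hd t (h *: a + t); rewrite subrr normr0 addrK normrZ => /(_ d0).
  have hv : `|h| * `|a| <= `|h| * (1 + `|a|) by rewrite ler_wpM2l// lerDr.
  move=> /(_ (le_lt_trans hv hd)) E.
  have -> : a *: v - h^-1 *: ((c \o shift t) (h *: a) - c t) =
      - h^-1 *: (c (h *: a + t) - c t - (h *: a) *: v).
    by apply/rowP => i; rewrite !mxE /= /GRing.scale/=; field.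
  rewrite normrZ normrN normfV mulrC ler_pdivrMr ?normr_gt0//.
  apply: (le_trans E).
  have -> : e / (1 + `|a|) * (`|h| * `|a|) = e * `|h| * (`|a| / (1 + `|a|)) by ring.
  rewrite ler_piMr ?mulr_ge0//; first exact: ltW.
  by rewrite ler_pdivrMr ?ltr_pwDl// mul1r lerDr.
by apply: DeriveDef; [apply/cvg_ex; exists (a *: v)|exact: cvg_lim].
Unshelve. all: by end_near. Qed.

(** A strict derivative is automatically continuous: for [s] near [t], the increment of [c] over one
    short step from [s] is governed both by [c' s] and by [c' t]. *)
Lemma sdiff1_Ck1 m (I : set R) (c c' : R -> 'rV[R]_m) : open I ->
  (forall t, I t -> sdiff1 c (c' t) t) ->
  Ck 1 I c /\ forall t, I t -> 'D_1 c t = c' t.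
Proof.
move=> oI Hc.
have D t : I t -> 'D_1 c t = c' t.
  by move=> It; have [_ ->] := sdiff1_is_derive 1 (Hc _ It); rewrite scale1r.
split=> //; split=> [t It|a].
  have [d _] := sdiff1_is_derive 1 (Hc _ It).
  exact/differentiable_continuous/derivable1_diffP.
split=> [t It|t It]; first by have [] := sdiff1_is_derive a (Hc _ It).
have H : {for t, continuous (fun s => a *: c' s)}.
  apply: (@cvgZl_tmp _ _ _ _ _ a c'); apply/cvgrPdist_le => e e0.
  have e2 : 0 < e / 2 by rewrite divr_gt0.
  have [d d0 Hd] := Hc _ It _ e2.
  have It' : nbhs t I by exact: open_nbhs_nbhs.
  near=> s.
  have Is : I s by near: s.
  have st : `|s - t| < d.
    by rewrite distrC; near: s; apply: cvgr_dist_lt.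
  have [d1 d10 Hd1] := Hc _ Is _ e2.
  (* Half of the minimum keeps [s + h] in the neighbourhoods of both [s] and [t]. *)
  pose h := Num.min d1 (d - `|s - t|) / 2.
  have h0 : 0 < h by rewrite divr_gt0// lt_min d10 subr_gt0.
  have hlt : h < Num.min d1 (d - `|s - t|).
    by rewrite /h ltr_pdivrMr// ltr_pMr ?lt_min ?d10 ?subr_gt0// (_ : 1 = 1%:R)// ltr_nat.
  move: hlt; rewrite lt_min => /andP[hd1 hd].
  have A1 := Hd1 s (s + h); rewrite subrr normr0 addrAC subrr add0r gtr0_norm// in A1.
  have A2 := Hd s (s + h) st.
  have {}A1 := A1 d10 hd1.
  have {}A2 : `|c (s + h) - c s - h *: c' t| <= e / 2 * h.
    have -> : c (s + h) - c s - h *: c' t = c (s + h) - c s - (s + h - s) *: c' t.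
      by rewrite [s + h - s]addrAC subrr add0r.
    rewrite (le_trans (A2 _))//; last by rewrite addrAC subrr add0r gtr0_norm.
    rewrite addrAC (le_lt_trans (ler_normD _ _))// (gtr0_norm h0).
    by move: hd; rewrite ltrBrDl.
  rewrite -(ler_pM2l h0).
  have -> : h * `|c' t - c' s| = `|(c (s + h) - c s - h *: c' s) - (c (s + h) - c s - h *: c' t)|.
    rewrite -(gtr0_norm h0) -normrZ gtr0_norm//; congr (`|_|).
    by apply/rowP => i; rewrite !mxE; ring.
  rewrite (le_trans (ler_normB _ _))// (le_trans (lerD A1 A2))//.
  by rewrite -mulrDl -splitr mulrC.
rewrite /prop_for /continuous_at in H *.
have [_ ->] := sdiff1_is_derive a (Hc _ It).
apply: cvg_trans H; apply: near_eq_cvg.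
have It' : nbhs t I by exact: open_nbhs_nbhs.
near=> s; have Is : I s by near: s.
by have [_ ->] := sdiff1_is_derive a (Hc _ Is).
Unshelve. all: by end_near. Qed.

End StrictDifferentiability.

(** * Solving an equation along a curve: a quantitative implicit function theorem *)

Section ImplicitCurve.
Variable R : realType.

(** It stands in for fixed points and projections: it minimises a residual in [correction_exists]
    and a distance in [cone_dense]. *)
Lemma lipschitz_attains_min m (A : set 'rV[R]_m) (f : 'rV[R]_m -> R) (K r : R) :
  A !=set0 -> closed A -> (forall x, A x -> `|x| <= r) ->
  (forall x y, A x -> A y -> `|f x - f y| <= K * `|x - y|) ->
  exists2 c, A c & forall x, A x -> f c <= f x.
Proof.
move=> A0 clA bA lipf.
have cA : compact A.
  apply: bounded_closed_compact => //; exists r; split; first exact: num_real.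
  by move=> M rM x /bA /le_trans; apply; exact: ltW.
have : {within A, continuous f}.
  apply/subspace_continuousP => x Ax; apply/cvgrPdist_le => e e0.
  have K0 : 0 < e / (1 + `|K|) by rewrite divr_gt0// ltr_pwDl.
  rewrite near_withinE; near=> y => Ay.
  apply: (le_trans (lipf _ _ Ax Ay)).
  have xy : `|x - y| < e / (1 + `|K|) by near: y; exact: cvgr_dist_lt.
  apply: (@le_trans _ _ ((1 + `|K|) * `|x - y|)).
    by rewrite ler_wpM2r// (le_trans (ler_norm K))// lerDr.
  by move: xy => /ltW; rewrite ler_pdivlMr ?ltr_pwDl// mulrC.
move=> /(compact_EVT_min A0 cA)[c /set_mem Ac Hc].
by exists c => // x Ax; apply: Hc; rewrite inE.
Unshelve. all: by end_near. Qed.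

Lemma norm_le_closed m (r : R) : closed [set s : 'rV[R]_m | `|s| <= r].
Proof.
rewrite (_ : [set _ | _] = (fun s : 'rV[R]_m => `|s|) @^-1` [set x | x <= r])//.
apply: closed_comp; last exact: closed_le.
by move=> x _; exact: norm_continuous.
Qed.

(** The same small increment [h *: v] is estimated through [A] and through [B]; dividing by [h]
    leaves the uniform error [e]. This is continuity of the derivative in quantitative form. *)
Lemma sdiff_jac_close n m (f : 'rV[R]_n -> 'rV[R]_m) A B p x (d e : R) :
  (forall y z, `|y - p| < d -> `|z - p| < d ->
     `|f z - f y - (z - y) *m A| <= e * `|z - y|) ->
  `|x - p| < d -> sdiff f B x -> forall v : 'rV_n, `|v *m B - v *m A| <= e * `|v|.
Proof.
move=> fA xp fB v; apply/ler_addgt0Pr => e' e'0.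
have v1 : 0 < 1 + `|v| by rewrite ltr_pwDl.
have e1 : 0 < e' / (1 + `|v|) by rewrite divr_gt0.
have [d' d'0 {}fB] := fB _ e1.
pose mn := Num.min d' (d - `|x - p|).
have mn0 : 0 < mn by rewrite lt_min d'0 subr_gt0.
pose h := mn / (1 + `|v|).
have h0 : 0 < h by rewrite divr_gt0.
have hv : h * `|v| < mn.
  rewrite /h mulrAC ltr_pdivrMr// ltr_pM2l//.
  by rewrite ltrDr.
move: hv; rewrite lt_min => /andP[hv1 hv2].
have nhv : `|h *: v| = h * `|v| by rewrite normrZ gtr0_norm.
have := fB x (x + h *: v); rewrite subrr normr0 addrAC subrr add0r nhv.
move=> /(_ d'0 hv1) E1.
have := fA x (x + h *: v) xp; rewrite [_ + _ - p]addrAC [_ + _ - x]addrAC subrr add0r nhv.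
have hh : `|x - p + h *: v| < d.
  by rewrite (le_lt_trans (ler_normD _ _))// nhv -ltrBrDl.
move=> /(_ hh) E2.
rewrite -(ler_pM2l h0).
have -> : h * `|v *m B - v *m A| = `|(f (x + h *: v) - f x - h *: v *m A) - (f (x + h *: v) - f x - h *: v *m B)|.
  rewrite -[in LHS](gtr0_norm h0) -normrZ; congr (`|_|).
  rewrite -!scalemxAl; move: (v *m A) (v *m B) => a b.
  by apply/rowP => i; rewrite !mxE; ring.
rewrite (le_trans (ler_normB _ _))// (le_trans (lerD E2 E1))//.
have -> : e * (h * `|v|) + e' / (1 + `|v|) * (h * `|v|) = h * (e * `|v| + e' * (`|v| / (1 + `|v|))) by ring.
rewrite ler_pM2l// lerD2l ler_piMr ?ltW//.
by rewrite ltr_pdivrMr// mul1r ltrDr.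
Qed.

Lemma norm_le_of_near_id m (Q : 'M[R]_m) :
  (forall s : 'rV_m, `|s *m Q - s| <= 2^-1 * `|s|) ->
  forall s : 'rV_m, `|s| <= 2 * `|s *m Q|.
Proof.
move=> H s; have := H s; have := ler_distD 0 s (s *m Q).
rewrite subr0 sub0r normrN [`|s - _|]distrC.
have := ler_normB (s *m Q) (s *m Q - s); rewrite opprB addrC subrK.
lra.
Qed.

Lemma near_id_unitmx m (Q : 'M[R]_m) :
  (forall s : 'rV_m, `|s *m Q - s| <= 2^-1 * `|s|) -> Q \in unitmx.
Proof.
move=> H; rewrite -row_free_unit; apply: inj_row_free => v vQ.
by apply/normr0_eq0/le_anti; rewrite normr_ge0 andbT
  (le_trans (norm_le_of_near_id H v))// vQ normr0 mulr0.
Qed.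

Section Correction.
Variables (a m : nat) (f : 'rV[R]_a -> 'rV[R]_m) (A : 'M[R]_(a, m)) (p : 'rV[R]_a).
Variables (P : 'M[R]_(m, a)) (KP d e : R).
Hypothesis fA : forall y z, `|y - p| < d -> `|z - p| < d ->
  `|f z - f y - (z - y) *m A| <= e * `|z - y|.
Hypothesis PA : forall s : 'rV_m, `|s *m P *m A - s| <= 4^-1 * `|s|.
Hypothesis KP0 : 0 < KP.
Hypothesis PK : forall s : 'rV_m, `|s *m P| <= KP * `|s|.
Hypothesis e0 : 0 <= e.
Hypothesis eKP : e * KP <= 4^-1.

(** Along the range of [P], [f] is the identity up to a 1/2-Lipschitz error: 1/4 from [PA] and 1/4
    from [eKP]. *)
Lemma correction_near_id b s s' :
  `|b + s *m P - p| < d -> `|b + s' *m P - p| < d ->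
  `|f (b + s' *m P) - f (b + s *m P) - (s' - s)| <= 2^-1 * `|s' - s|.
Proof.
move=> h1 h2; have := fA h1 h2.
have -> : b + s' *m P - (b + s *m P) = (s' - s) *m P.
  by rewrite mulmxBl opprD addrACA subrr add0r.
move=> E1; have E2 := PA (s' - s).
have E3 : e * `|(s' - s) *m P| <= 4^-1 * `|s' - s|.
  apply: (@le_trans _ _ (e * (KP * `|s' - s|))); first by rewrite ler_wpM2l.
  by rewrite mulrA ler_wpM2r.
have -> : f (b + s' *m P) - f (b + s *m P) - (s' - s) =
  (f (b + s' *m P) - f (b + s *m P) - (s' - s) *m P *m A) +
  ((s' - s) *m P *m A - (s' - s)) by rewrite addrA subrK.
rewrite (le_trans (ler_normD _ _))//; lra.
Qed.

(** A Newton step [s - f (b + s *m P)] at least halves the residual, so a point where the residual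
    is minimal is a zero. *)
Lemma correction_exists b : `|b - p| + KP * (2 * `|f b|) < d ->
  exists2 s, `|s| <= 2 * `|f b| & f (b + s *m P) = 0.
Proof.
set r := 2 * `|f b| => bd.
have r0 : 0 <= r by rewrite mulr_ge0.
have inb s : `|s| <= r -> `|b + s *m P - p| < d.
  move=> sr; rewrite addrAC (le_lt_trans (ler_normD _ _))//.
  rewrite (le_lt_trans _ bd)// lerD2l (le_trans (PK s))// ler_wpM2l//.
  exact: ltW.
have near s s' : `|s| <= r -> `|s'| <= r ->
    `|f (b + s' *m P) - f (b + s *m P) - (s' - s)| <= 2^-1 * `|s' - s|.
  by move=> /inb h1 /inb h2; apply: correction_near_id.
have [||s sr|s s' sr s'r|s sr smin] := @lipschitz_attains_min m
    [set s | `|s| <= r] (fun s => `|f (b + s *m P)|) 2 r.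
- by exists 0; rewrite /= normr0.
- exact: norm_le_closed.
- exact: sr.
- have := near _ _ s'r sr.
  have := ler_normD (f (b + s *m P) - f (b + s' *m P) - (s - s')) (s - s').
  rewrite subrK.
  have := lerB_dist (f (b + s *m P)) (f (b + s' *m P)).
  have := lerB_dist (f (b + s' *m P)) (f (b + s *m P)).
  rewrite [`|f (b + s' *m P) - f (b + s *m P)|]distrC => h1 h2 h3 h4.
  have := normr_ge0 (s - s').
  by rewrite ler_norml; move=> ?; apply/andP; split; lra.
exists s => //.
(* The step does not leave the ball of radius [2 * |f b|], as [|s'| <= |s| / 2 + |f b|]. *)
pose s' := s - f (b + s *m P).
have s'r : `|s'| <= r.
  have := near 0 s; rewrite /= normr0 mul0mx addr0 subr0 => /(_ r0 sr) H.
  have -> : s' = - (f (b + s *m P) - f b - s) - f b.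
    by apply/rowP => i; rewrite !mxE; ring.
  rewrite (le_trans (ler_normB _ _))// normrN.
  move: sr; rewrite /= /r; move: H; set x := `|_|; set y := `|s|; set z := `|f b|.
  lra.
have := near _ _ sr s'r; have := smin _ s'r.
have -> : s' - s = - f (b + s *m P) by rewrite /s' addrAC subrr add0r.
rewrite opprK subrK normrN => h1 h2.
apply/eqP; rewrite -normr_le0; lra.
Qed.

(** Both solutions are compared at the mixed point [b2 + s1 *m P], where [f] is at most
    [L * |b2 - b1|]. Hence any pointwise choice of solutions is Lipschitz. *)
Lemma correction_lipschitz b1 b2 s1 s2 L :
  (forall y z, `|y - p| < d -> `|z - p| < d -> `|f z - f y| <= L * `|z - y|) ->
  `|b1 + s1 *m P - p| < d -> `|b2 + s2 *m P - p| < d -> `|b2 + s1 *m P - p| < d ->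
  f (b1 + s1 *m P) = 0 -> f (b2 + s2 *m P) = 0 ->
  `|s2 - s1| <= 2 * (L * `|b2 - b1|).
Proof.
move=> Lf h1 h2 h12 f1 f2.
have := correction_near_id h12 h2; rewrite f2 sub0r.
have := Lf _ _ h1 h12; rewrite f1 subr0.
have -> : b2 + s1 *m P - (b1 + s1 *m P) = b2 - b1.
  by rewrite opprD addrACA subrr addr0.
have := ler_normB (- f (b2 + s1 *m P) - (s2 - s1)) (- f (b2 + s1 *m P)).
rewrite opprK addrAC addNr add0r !normrN; lra.
Qed.

End Correction.

(** The radius [rho] depends neither on the curve [b] nor on [I], so it serves all chords at once.
    Bounding [s] and [s'] by the residual and its first-order variation makes the correction small
    later, and zero wherever [f (b t) = 0]. *)
Lemma implicit_curve a m (f : 'rV[R]_a -> 'rV[R]_m) (J : 'rV[R]_a -> 'M[R]_(a, m))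
    (p : 'rV[R]_a) (P : 'M[R]_(m, a)) (dU : R) : 0 < dU ->
  (forall x, `|x - p| < dU -> sdiff f (J x) x) -> f p = 0 ->
  (forall s : 'rV_m, `|s *m P *m J p - s| <= 4^-1 * `|s|) ->
  exists2 rho : R, 0 < rho & forall (I : set R) (b b' : R -> 'rV[R]_a), open I ->
    (forall t, I t -> `|b t - p| < rho) ->
    (forall t, I t -> sdiff1 b (b' t) t) ->
    exists s s' : R -> 'rV[R]_m, forall t, I t ->
      [/\ sdiff1 s (s' t) t, f (b t + s t *m P) = 0, `|s t| <= 2 * `|f (b t)|,
          `|s' t| <= 2 * `|b' t *m J (b t + s t *m P)| &
          `|b t + s t *m P - p| < dU].
Proof.
move=> dU0 fJ fp PJ.
have [KP KP0 PK] := mulmx_bounded P.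
have [KA KA0 AK] := mulmx_bounded (J p).
pose e := 4^-1 / KP; have e0 : 0 < e by rewrite divr_gt0// invr_gt0.
have eKP : e * KP <= 4^-1 by rewrite divfK// gt_eqF.
have pp : `|p - p| < dU by rewrite subrr normr0.
have [d0 d00 fA0] := fJ _ pp _ e0.
pose d := Num.min d0 dU; have dgt0 : 0 < d by rewrite lt_min d00.
have fA y z : `|y - p| < d -> `|z - p| < d ->
    `|f z - f y - (z - y) *m J p| <= e * `|z - y|.
  by rewrite !lt_min => /andP[y0 _] /andP[z0 _]; apply: fA0.
pose L := e + KA; have L0 : 0 < L by rewrite addr_gt0.
have Lf y z : `|y - p| < d -> `|z - p| < d -> `|f z - f y| <= L * `|z - y|.
  move=> hy hz; rewrite -[f z - f y](subrK ((z - y) *m J p)).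
  rewrite (le_trans (ler_normD _ _))// mulrDl lerD//; exact: fA.
have c0 : 0 < 1 + KP * (2 * L) by rewrite addr_gt0// !mulr_gt0.
(* As [|s t| <= 2 * (L * rho)], the curve and its correction together stay within [d / 2] of [p],
   where [fA] applies. *)
pose rho := d / (2 * (1 + KP * (2 * L))).
have rho0 : 0 < rho by rewrite divr_gt0// mulr_gt0.
have rhoE : rho + KP * (2 * L) * rho = d / 2.
  by rewrite /rho; field; rewrite gt_eqF.
have d2 : d / 2 < d by rewrite ltr_pdivrMr// ltr_pMr// (_ : 1 = 1%:R)// ltr_nat.
have rhod : rho < d.
  apply: le_lt_trans d2; rewrite -rhoE lerDl.
  by apply: mulr_ge0; [rewrite !mulr_ge0// ltW|exact: ltW].
exists rho => // I b b' oI brho bb'.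
have fb t : I t -> `|f (b t)| <= L * rho.
  move=> It; have := Lf p (b t); rewrite subrr normr0 fp subr0 => /(_ dgt0).
  move=> /(_ (lt_trans (brho _ It) rhod)) /le_trans; apply.
  by rewrite ler_pM2l// ltW// brho.
have /choice[s Hs] : forall t, exists s, I t ->
    `|s| <= 2 * `|f (b t)| /\ f (b t + s *m P) = 0.
  move=> t; have [It|nIt] := pselect (I t); last by exists 0.
  have [|s s1 s2] := correction_exists fA PJ KP0 PK (ltW e0) eKP (b := b t).
    apply: le_lt_trans d2; rewrite -rhoE lerD//; first by rewrite ltW// brho.
    by rewrite -!mulrA !ler_pM2l// fb.
  by exists s.
pose gam t := b t + s t *m P.
(* Two separate times, because [correction_lipschitz] needs the mixed points. *)
have near u t : I u -> I t -> `|b t + s u *m P - p| < d.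
  move=> Iu It; apply: le_lt_trans d2; rewrite addrAC (le_trans (ler_normD _ _))//.
  rewrite -rhoE lerD//; first by rewrite ltW// brho.
  rewrite (le_trans (PK _))// -!mulrA ler_pM2l//.
  by rewrite (le_trans (Hs _ Iu).1)// ler_pM2l// fb.
have gamU t : I t -> `|gam t - p| < dU.
  by move=> It; have := near _ _ It It; rewrite lt_min => /andP[].
have Q t : I t -> forall u : 'rV_m, `|u *m (P *m J (gam t)) - u| <= 2^-1 * `|u|.
  move=> It u.
  have := sdiff_jac_close fA (near _ _ It It) (fJ _ (gamU _ It)) (u *m P).
  have := PJ u; rewrite mulmxA.
  have : e * `|u *m P| <= 4^-1 * `|u|.
    apply: (@le_trans _ _ (e * (KP * `|u|))); first by rewrite ler_pM2l.
    by rewrite mulrA ler_wpM2r.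
  rewrite -/(gam t).
  have := ler_distD (u *m P *m J p) (u *m P *m J (gam t)) u.
  lra.
(* The candidate derivative comes from differentiating [f (b t + s t *m P) = 0]. *)
have /choice[s' Hs'] : forall t, exists s' : 'rV[R]_m, I t ->
    s' *m (P *m J (gam t)) = - (b' t *m J (gam t)).
  move=> t; have [It|nIt] := pselect (I t); last by exists 0.
  exists (- (b' t *m J (gam t)) *m invmx (P *m J (gam t))) => _.
  by rewrite mulmxKV// near_id_unitmx//; exact: Q.
exists s, s' => t It; split; [|exact: (Hs _ It).2|exact: (Hs _ It).1| |exact: gamU]; last first.
  by rewrite (le_trans (norm_le_of_near_id (Q _ It) _))// Hs'// normrN.
move=> eps eps0.
have [KJ KJ0 JK] := mulmx_bounded (J (gam t)).
(* [G] will be a Lipschitz constant of [gam] near [t]. The two errors [eps / 4] below get doubled by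
   [norm_le_of_near_id]. *)
pose G := (1 + KP * (2 * L)) * (1 + `|b' t|).
have G0 : 0 < G by rewrite mulr_gt0// ltr_pwDl.
have e10 : 0 < eps / (4 * G) by rewrite divr_gt0// mulr_gt0.
have [d1 d10 H1] := fJ _ (gamU _ It) _ e10.
pose e2 := Num.min 1 (eps / (4 * KJ)).
have e20 : 0 < e2 by rewrite lt_min ltr01 divr_gt0// mulr_gt0.
have [d2' d20 H2] := bb' _ It _ e20.
have /nbhs_normP[d3 /= d30 H3] : nbhs t I by exact: open_nbhs_nbhs.
pose d4 := Num.min (Num.min d2' d3) (d1 / G).
exists d4; first by rewrite !lt_min d20 d30 divr_gt0.
have inI y : `|y - t| < d4 -> [/\ I y, `|y - t| < d2' & G * `|y - t| < d1].
  rewrite !lt_min => /andP[/andP[h2 h3] h1]; split=> //.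
    by apply: H3; rewrite /= distrC.
  by rewrite mulrC -ltr_pdivlMr.
have bLip y z : `|y - t| < d2' -> `|z - t| < d2' ->
    `|b z - b y| <= (1 + `|b' t|) * `|z - y|.
  move=> hy hz; rewrite -[b z - b y](subrK ((z - y) *: b' t)).
  rewrite (le_trans (ler_normD _ _))// mulrDl lerD//; last by rewrite normrZ mulrC.
  by rewrite (le_trans (H2 _ _ hy hz))// ler_wpM2r// ge_min lexx.
have sLip y z : I y -> I z -> `|s z - s y| <= 2 * (L * `|b z - b y|).
  move=> Iy Iz.
  apply: (correction_lipschitz fA PJ PK (ltW e0) eKP Lf); try exact: near.
    exact: (Hs _ Iy).2.
  exact: (Hs _ Iz).2.
have gLip y z : `|y - t| < d4 -> `|z - t| < d4 -> `|gam z - gam y| <= G * `|z - y|.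
  move=> /inI[Iy hy _] /inI[Iz hz _].
  have -> : gam z - gam y = (b z - b y) + (s z - s y) *m P.
    by rewrite /gam mulmxBl opprD addrACA.
  rewrite (le_trans (ler_normD _ _))// (le_trans (lerD (lexx _) (PK _)))//.
  apply: (@le_trans _ _ ((1 + KP * (2 * L)) * `|b z - b y|)).
    rewrite mulrDl mul1r lerD2l -!mulrA ler_pM2l//; exact: sLip.
  by rewrite /G -mulrA ler_pM2l// bLip.
have tt4 : `|t - t| < d4 by rewrite subrr normr0 !lt_min d20 d30 divr_gt0.
move=> y z hy hz.
have [Iy hy2 hy1] := inI _ hy; have [Iz hz2 hz1] := inI _ hz.
have E1 := H1 (gam y) (gam z) (le_lt_trans (gLip _ _ tt4 hy) hy1)
  (le_lt_trans (gLip _ _ tt4 hz) hz1).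
rewrite /gam (Hs _ Iy).2 (Hs _ Iz).2 -/(gam y) -/(gam z) subrr sub0r normrN in E1.
have {}E1 : `|(gam z - gam y) *m J (gam t)| <= eps / 4 * `|z - y|.
  apply: (le_trans E1).
  apply: (@le_trans _ _ (eps / (4 * G) * (G * `|z - y|))).
    by rewrite ler_pM2l// gLip.
  suff -> : eps / (4 * G) * (G * `|z - y|) = eps / 4 * `|z - y| by [].
  by field; rewrite gt_eqF.
have E2 := H2 _ _ hy2 hz2.
have {}E2 : `|(b z - b y - (z - y) *: b' t) *m J (gam t)| <= eps / 4 * `|z - y|.
  apply: (le_trans (JK _)).
  apply: (@le_trans _ _ (KJ * (eps / (4 * KJ) * `|z - y|))).
    rewrite ler_pM2l// (le_trans E2)// ler_wpM2r//.
    by rewrite ge_min lexx orbT.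
  suff -> : KJ * (eps / (4 * KJ) * `|z - y|) = eps / 4 * `|z - y| by [].
  by field; rewrite gt_eqF.
(* Multiplication by [P *m J (gam t)] expresses the error of [s] through the increment of [gam],
   nearly killed by [J (gam t)] since [f] vanishes at [gam y] and [gam z], and the error of [b]. *)
apply: (le_trans (norm_le_of_near_id (Q _ It) _)).
have -> : (s z - s y - (z - y) *: s' t) *m (P *m J (gam t)) =
    (gam z - gam y) *m J (gam t) - (b z - b y - (z - y) *: b' t) *m J (gam t).
  have -> : gam z - gam y = (b z - b y) + (s z - s y) *m P.
    by rewrite /gam mulmxBl opprD addrACA.
  rewrite mulmxBl -scalemxAl Hs'// [in RHS]mulmxDl [X in _ = _ - X]mulmxBl -scalemxAl -mulmxA.
  move: ((s z - s y) *m _) ((b z - b y) *m _) (b' t *m _) => X Y Z.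
  by apply/rowP => i; rewrite !mxE; ring.
have := ler_normB ((gam z - gam y) *m J (gam t)) ((b z - b y - (z - y) *: b' t) *m J (gam t)).
lra.
Qed.

End ImplicitCurve.

(** * Euclidean inner product and norm, compared with the max norm *)

Section Euclidean.
Variable R : realType.
Implicit Types n : nat.

Lemma dotvC n (u v : 'rV[R]_n) : dotv u v = dotv v u.
Proof. by apply: eq_bigr => i _; rewrite mulrC. Qed.

Lemma dotvDr n (u v w : 'rV[R]_n) : dotv u (v + w) = dotv u v + dotv u w.
Proof. by rewrite -big_split; apply: eq_bigr => i _; rewrite mxE mulrDr. Qed.

Lemma dotvZr n (a : R) (u v : 'rV[R]_n) : dotv u (a *: v) = a * dotv u v.
Proof. by rewrite /dotv mulr_sumr; apply: eq_bigr => i _; rewrite mxE mulrCA. Qed.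

Lemma dotvNr n (u v : 'rV[R]_n) : dotv u (- v) = - dotv u v.
Proof. by rewrite -scaleN1r dotvZr mulN1r. Qed.

Lemma dotvBr n (u v w : 'rV[R]_n) : dotv u (v - w) = dotv u v - dotv u w.
Proof. by rewrite dotvDr dotvNr. Qed.

Lemma dotv_ge0 n (u : 'rV[R]_n) : 0 <= dotv u u.
Proof. by apply: sumr_ge0 => i _; rewrite -expr2 sqr_ge0. Qed.

Lemma enorm_ge0 n (u : 'rV[R]_n) : 0 <= enorm u.
Proof. exact: sqrtr_ge0. Qed.

Lemma sqr_enorm n (u : 'rV[R]_n) : enorm u ^+ 2 = dotv u u.
Proof. by rewrite sqr_sqrtr// dotv_ge0. Qed.

Lemma norm_le_enorm n (u : 'rV[R]_n) : `|u| <= enorm u.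
Proof.
apply: rv_norm_le => [|i]; first exact: enorm_ge0.
rewrite -(@ler_pXn2r _ 2) ?nnegrE ?enorm_ge0// sqr_enorm /dotv (bigD1 i)//=.
rewrite -normrX ger0_norm ?sqr_ge0// expr2 lerDl sumr_ge0// => j _.
by rewrite -expr2 sqr_ge0.
Qed.

Lemma enorm_le_norm n (u : 'rV[R]_n) : enorm u <= n%:R * `|u|.
Proof.
rewrite -(@ler_pXn2r _ 2) ?nnegrE ?enorm_ge0 ?mulr_ge0// sqr_enorm.
apply: (@le_trans _ _ (\sum_(i < n) `|u| ^+ 2)).
  apply: ler_sum => i _; rewrite -expr2 -[X in X <= _]ger0_norm ?sqr_ge0// normrX.
  by rewrite ler_pXn2r ?nnegrE// le_rv_norm.
rewrite sumr_const card_ord -[leLHS]mulr_natl exprMn ler_wpM2r ?sqr_ge0//.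
by rewrite -natrX ler_nat; case: n {u} => // n; rewrite -mulnn leq_pmulr.
Qed.

Lemma enorm0 n : enorm (0 : 'rV[R]_n) = 0.
Proof.
by apply/le_anti; rewrite enorm_ge0 (le_trans (enorm_le_norm _))// normr0 mulr0.
Qed.

Lemma enormZ n (a : R) (u : 'rV[R]_n) : enorm (a *: u) = `|a| * enorm u.
Proof.
rewrite /enorm dotvZr dotvC dotvZr mulrA -expr2 sqrtrM ?sqr_ge0//.
by rewrite sqrtr_sqr.
Qed.

Lemma enormN n (u : 'rV[R]_n) : enorm (- u) = enorm u.
Proof. by rewrite -scaleN1r enormZ normrN1 mul1r. Qed.

Lemma enorm_dist_sym n (u v : 'rV[R]_n) : enorm (u - v) = enorm (v - u).
Proof. by rewrite -enormN opprB. Qed.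

(** Expand the square of [enorm v *: u - enorm u *: v]; zero vectors are treated apart so that the
    product of the norms can be cancelled. *)
Lemma dotv_le_enorm n (u v : 'rV[R]_n) : dotv u v <= enorm u * enorm v.
Proof.
have [/eqP u0|u0] := boolP (enorm u == 0).
  have /normr0_eq0 -> : `|u| = 0.
    by apply/le_anti; rewrite normr_ge0 andbT -u0 norm_le_enorm.
  by rewrite enorm0 mul0r -(scale0r 0) dotvC dotvZr mul0r.
have [/eqP v0|v0] := boolP (enorm v == 0).
  have /normr0_eq0 -> : `|v| = 0.
    by apply/le_anti; rewrite normr_ge0 andbT -v0 norm_le_enorm.
  by rewrite enorm0 mulr0 -(scale0r 0) dotvZr mul0r.
have p : 0 < enorm u * enorm v by rewrite mulr_gt0// lt_def enorm_ge0 andbT.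
have := dotv_ge0 (enorm v *: u - enorm u *: v).
rewrite !(dotvBr, dotvZr) ![dotv (_ - _) _]dotvC !(dotvBr, dotvZr) -!sqr_enorm [dotv v u]dotvC.
move: p; set x := enorm u; set y := enorm v; set z := dotv u v => p h.
have {}h : 0 <= x * y * (x * y - z).
  have -> : x * y * (x * y - z) = (y * (y * x ^+ 2 - x * z) - x * (y * z - x * y ^+ 2)) / 2.
    by field.
  by rewrite divr_ge0.
by move: h; rewrite pmulr_rge0// subr_ge0.
Qed.

Lemma sqr_enormD n (u v : 'rV[R]_n) :
  enorm (u + v) ^+ 2 = enorm u ^+ 2 + 2 * dotv u v + enorm v ^+ 2.
Proof.
rewrite !sqr_enorm /dotv mulr_sumr -!big_split/=; apply: eq_bigr => i _.
by rewrite !mxE; ring.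
Qed.

Lemma enormD n (u v : 'rV[R]_n) : enorm (u + v) <= enorm u + enorm v.
Proof.
rewrite -(@ler_pXn2r _ 2) ?nnegrE ?addr_ge0 ?enorm_ge0//.
rewrite sqr_enormD; have := dotv_le_enorm u v; lra.
Qed.

Lemma enorm_triangle n (u v w : 'rV[R]_n) : enorm (u - w) <= enorm (u - v) + enorm (v - w).
Proof. by rewrite (_ : u - w = (u - v) + (v - w)) ?enormD// addrA subrK. Qed.

Lemma parallelogram n (u v : 'rV[R]_n) :
  enorm (u + v) ^+ 2 + enorm (u - v) ^+ 2 = 2 * (enorm u ^+ 2 + enorm v ^+ 2).
Proof.
rewrite !sqr_enorm /dotv -!big_split/= mulr_sumr; apply: eq_bigr => i _.
by rewrite !mxE; ring.
Qed.

Lemma enorm_lipschitz n (u v : 'rV[R]_n) : `|enorm u - enorm v| <= n%:R * `|u - v|.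
Proof.
apply: le_trans (enorm_le_norm _).
rewrite ler_norml; apply/andP; split.
  rewrite lerNl opprB lerBlDr enorm_dist_sym.
  by have := enorm_triangle v u 0; rewrite !subr0.
by rewrite lerBlDr; have := enorm_triangle u v 0; rewrite !subr0.
Qed.

Lemma lipschitz_continuous n (f : 'rV[R]_n -> R) (K : R) :
  (forall u v, `|f u - f v| <= K * `|u - v|) -> continuous f.
Proof.
move=> lipf u; apply: (iffRL (@cvgrPdist_le _ _ _ (nbhs u) _ _ _)) => e e0.
near=> v; apply: (le_trans (lipf _ _)).
have K0 : 0 < 1 + `|K| by rewrite ltr_pwDl.
have uv : `|u - v| < e / (1 + `|K|).
  by near: v; apply: cvgr_dist_lt => //; rewrite divr_gt0.
move: uv => /ltW; rewrite ler_pdivlMr// mulrC; apply: le_trans.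
by rewrite ler_wpM2r// (le_trans (ler_norm K))// lerDr.
Unshelve. all: by end_near. Qed.

Lemma enorm_continuous n : continuous (@enorm R n).
Proof. exact: lipschitz_continuous (@enorm_lipschitz n). Qed.

Lemma dotv_continuous n (w : 'rV[R]_n) : continuous (dotv w).
Proof.
apply: (@lipschitz_continuous _ _ (enorm w * n%:R)) => u v.
rewrite -dotvBr -mulrA.
apply: (@le_trans _ _ (enorm w * enorm (u - v))); last first.
  by rewrite ler_wpM2l ?enorm_ge0 ?enorm_le_norm.
rewrite ler_norml dotv_le_enorm andbT lerNl -dotvNr.
by rewrite (le_trans (dotv_le_enorm _ _))// enormN.
Qed.

End Euclidean.

(** * Length of curves, intrinsic distance and chords *)

Section Length.
Variables (R : realType) (n : nat).
Local Notation mu := (@lebesgue_measure R).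

Lemma within01_continuous (V : topologicalType) (O : set R) (f : R -> V) :
  @Rint01 R `<=` O -> (forall t, O t -> {for t, continuous f}) ->
  {within `[0, 1], continuous f}.
Proof.
move=> IO cf; apply: continuous_in_subspaceT => t; rewrite inE/= in_itv/= => It.
by apply: cf; apply: IO.
Qed.

Lemma integrable01_continuous (f : R -> R) :
  {within `[0, 1], continuous f} -> mu.-integrable `[0, 1] (EFin \o f).
Proof. by move=> cf; apply: continuous_compact_integrable => //; exact: segment_compact. Qed.

Lemma speed_integrable S x y (gam : R -> 'rV[R]_n) : C1_curve_in S x y gam ->
  mu.-integrable `[0, 1] (fun t => (enorm ('D_1 gam t))%:E).
Proof.
move=> [ O [oO [IO [[_ /(_ 1)[_ cD]] _]]]].
apply: (@integrable01_continuous (fun t => enorm ('D_1 gam t))).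
apply: (within01_continuous IO) => t Ot.
by apply: continuous_comp; [exact: cD|exact: enorm_continuous].
Qed.

(** Integrate the velocity projected on the unit vector [u] of the chord: the integral is the length
    of the chord, and the projection is at most the speed. *)
Lemma chord_le_curve_length S x y (gam : R -> 'rV[R]_n) : C1_curve_in S x y gam ->
  ((enorm (y - x))%:E <= curve_length gam)%E.
Proof.
move=> gamC; have iD := speed_integrable gamC.
case: gamC => O [oO [IO [[cg /(_ 1)[dg cD]] [_ [g0 g1]]]]].
have [e0|e0] := eqVneq (enorm (y - x)) 0.
  by rewrite e0 integral_ge0// => t _; rewrite lee_fin enorm_ge0.
have ep : 0 < enorm (y - x) by rewrite lt_def e0 enorm_ge0.
pose u := (enorm (y - x))^-1 *: (y - x).
have nu : enorm u = 1 by rewrite enormZ gtr0_norm ?invr_gt0// mulVf.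
pose phi t := dotv u (gam t).
have dphi t : O t -> is_derive t 1 phi (dotv u ('D_1 gam t)).
  move=> Ot; have /cvg_ex[l Hl] := dg _ Ot.
  have lE : 'D_1 gam t = l by exact: cvg_lim Hl.
  have : dotv u (h^-1 *: ((gam \o shift t) (h *: 1) - gam t)) @[h --> 0^'] --> dotv u l.
    by apply: cvg_comp Hl _; exact: dotv_continuous.
  rewrite (_ : (fun h => dotv u _) = (fun h => h^-1 *: ((phi \o shift t) (h *: 1) - phi t))); last first.
    by apply/funext => h; rewrite dotvZr dotvBr.
  move=> H; rewrite lE; apply: DeriveDef; first by apply/cvg_ex; exists (dotv u l).
  exact: cvg_lim H.
have cphi : {within `[0, 1], continuous phi}.
  apply: (within01_continuous IO) => t Ot.
  by apply: continuous_comp; [exact: cg|exact: dotv_continuous].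
have cdphi : {within `[0, 1], continuous (fun t => dotv u ('D_1 gam t))}.
  apply: (within01_continuous IO) => t Ot.
  by apply: continuous_comp; [exact: cD|exact: dotv_continuous].
have sub t : t \in `]0, 1[ -> O t.
  by rewrite in_itv/= => /andP[t0 t1]; apply: IO; rewrite /Rint01/= !ltW.
have FTC : (\int[mu]_(t in `[0%R, 1%R]) (dotv u ('D_1 gam t))%:E = (phi 1)%:E - (phi 0)%:E)%E.
  apply: continuous_FTC2 => //.
    have [_ c0 c1] := (continuous_within_itvP _ (@ltr01 R)).1 cphi.
    by split=> // t /sub /dphi[].
  by move=> t /sub Ot; rewrite derive1E; have [_ ->] := dphi _ Ot.
have -> : (enorm (y - x))%:E = ((phi 1)%:E - (phi 0)%:E)%E.
  rewrite -EFinB /phi g0 g1 -dotvBr /u dotvC dotvZr -sqr_enorm expr2 mulKf//.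
rewrite -FTC; apply: le_integral => //; first exact: integrable01_continuous cdphi.
by move=> t _; rewrite lee_fin (le_trans (dotv_le_enorm _ _))// nu mul1r.
Qed.

Lemma curve_length_le S x y (gam : R -> 'rV[R]_n) c : C1_curve_in S x y gam ->
  (forall t, Rint01 t -> enorm ('D_1 gam t) <= c) -> (curve_length gam <= c%:E)%E.
Proof.
move=> gamC Hc; have iD := speed_integrable gamC.
have -> : c%:E = (\int[mu]_(t in `[0%R, 1%R]) (cst c%:E) t)%E.
  rewrite integral_cst//= lebesgue_measure_itv/= lte_fin ltr01.
  by rewrite -EFinB subr0 mule1.
apply: le_integral => //.
  apply: (@integrable01_continuous (cst c)).
  by apply: continuous_subspaceT; exact: cst_continuous.
move=> t; rewrite inE/= in_itv/= => It; rewrite lee_fin; exact: Hc.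
Qed.

Lemma chord_le_dM (M : set 'rV[R]_n) x y : ((enorm (y - x))%:E <= dM M x y)%E.
Proof. by apply: le_ereal_inf_tmp => _ [gam [gamC ->]]; exact: chord_le_curve_length gamC. Qed.

Lemma dM_le (M : set 'rV[R]_n) x y gam c : C1_curve_in M x y gam ->
  (forall t, Rint01 t -> enorm ('D_1 gam t) <= c) -> (dM M x y <= c%:E)%E.
Proof.
move=> gamC Hc; apply: le_trans (curve_length_le gamC Hc).
by apply: ereal_inf_lbound; exists gam.
Qed.

End Length.

(** * Curves close to chords in a submanifold *)

Section ChordCurves.
Variable R : realType.

Lemma fin_uniform n (Q : 'I_n -> R -> Prop) :
  (forall i d d', 0 < d' -> d' <= d -> Q i d -> Q i d') ->
  (forall i, exists2 d, 0 < d & Q i d) -> exists2 d, 0 < d & forall i, Q i d.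
Proof.
move=> mono H.
have /choice[d Hd] : forall i, exists d, 0 < d /\ Q i d.
  by move=> i; have [d ? ?] := H i; exists d.
have d0 : 0 < \big[Num.min/1]_i d i by apply: lt_bigmin => // i _; have [] := Hd i.
exists (\big[Num.min/1]_i d i) => // i.
apply: (mono i (d i)) => //; last by have [] := Hd i.
exact: bigmin_le_cond.
Qed.

Lemma sdiff_lipschitz n m (f : 'rV[R]_n -> 'rV[R]_m) A p : sdiff f A p ->
  exists2 d : R, 0 < d & exists2 L : R, 0 < L & forall y z,
    `|y - p| < d -> `|z - p| < d -> `|f z - f y| <= L * `|z - y|.
Proof.
move=> fA; have [K K0 AK] := mulmx_bounded A; have [d d0 Hd] := fA _ ltr01.
exists d => //; exists (1 + K) => [|y z hy hz]; first by rewrite addr_gt0.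
rewrite -[f z - f y](subrK ((z - y) *m A)).
rewrite (le_trans (ler_normD _ _))// mulrDl lerD//; exact: Hd.
Qed.

Lemma sdiff1D m (c1 c2 : R -> 'rV[R]_m) v1 v2 t :
  sdiff1 c1 v1 t -> sdiff1 c2 v2 t -> sdiff1 (fun t => c1 t + c2 t) (v1 + v2) t.
Proof.
move=> h1 h2 e e0; have e2 : 0 < e / 2 by rewrite divr_gt0.
have [d1 d10 {}h1] := h1 _ e2; have [d2 d20 {}h2] := h2 _ e2.
exists (Num.min d1 d2) => [|y z]; first by rewrite lt_min d10.
rewrite !lt_min => /andP[y1 y2] /andP[z1 z2].
have -> : c1 z + c2 z - (c1 y + c2 y) - (z - y) *: (v1 + v2) =
  (c1 z - c1 y - (z - y) *: v1) + (c2 z - c2 y - (z - y) *: v2).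
  by apply/rowP => i; rewrite !mxE; ring.
rewrite (le_trans (ler_normD _ _))// [e]splitr mulrDl lerD//; [exact: h1|exact: h2].
Qed.

Lemma sdiff1_mulmx m k (c : R -> 'rV[R]_m) v t (P : 'M[R]_(m, k)) :
  sdiff1 c v t -> sdiff1 (fun t => c t *m P) (v *m P) t.
Proof.
move=> h e e0; have [K K0 PK] := mulmx_bounded P.
have [|d d0 {}h] := h (e / K); first by rewrite divr_gt0.
exists d => // y z hy hz; rewrite scalemxAl -!mulmxBl (le_trans (PK _))//.
by have := h _ _ hy hz; rewrite mulrAC ler_pdivlMr// mulrC.
Qed.

Lemma sdiff1_affine m (x v : 'rV[R]_m) t : sdiff1 (fun t => x + t *: v) v t.
Proof.
move=> e e0; exists 1 => // y z _ _.
have -> : x + z *: v - (x + y *: v) - (z - y) *: v = 0.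
  by apply/rowP => i; rewrite !mxE; ring.
by rewrite normr0 mulr_ge0// ltW.
Qed.

Lemma sdiff1_quadratic m (v : 'rV[R]_m) k t :
  sdiff1 (fun t => (k * (t * (1 - t))) *: v) ((k * (1 - 2 * t)) *: v) t.
Proof.
move=> e e0; pose q := 2 * (1 + `|k| * `|v|).
have q0 : 0 < q by rewrite mulr_gt0// ltr_pwDl// mulr_ge0.
exists (e / q) => [|y z hy hz]; first by rewrite divr_gt0.
have -> : (k * (z * (1 - z))) *: v - (k * (y * (1 - y))) *: v
    - (z - y) *: ((k * (1 - 2 * t)) *: v) =
    (k * ((z - y) * - ((z - t) + (y - t)))) *: v.
  by apply/rowP => i; rewrite !mxE; ring.
rewrite normrZ !normrM normrN.
have h : `|z - t + (y - t)| <= 2 * (e / q).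
  by rewrite (le_trans (ler_normD _ _))// [2]mulr2n mulrDl mul1r lerD// ltW.
apply: (@le_trans _ _ (`|k| * (`|z - y| * (2 * (e / q))) * `|v|)).
  by rewrite ler_wpM2r// ler_wpM2l// ler_wpM2l.
have -> : `|k| * (`|z - y| * (2 * (e / q))) * `|v| =
    e * `|z - y| * (2 * (`|k| * `|v|) / q) by ring.
rewrite ler_piMr//; first by rewrite mulr_ge0// ltW.
by rewrite ler_pdivrMr// mul1r /q mulrDr lerDr.
Qed.

(** All curves are built on [|t| < 2], an open neighbourhood of the unit interval, where
    [|1 - t| <= 3] and [|t| <= 2]; the constants 5 in the radii below come from here. *)
Lemma interp_sub_norm m (x y p : 'rV[R]_m) (t r : R) : `|t| < 2 ->
  `|x - p| <= r -> `|y - p| <= r -> `|x + t *: (y - x) - p| <= 5 * r.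
Proof.
move=> t2 hx hy.
have -> : x + t *: (y - x) - p = (1 - t) *: (x - p) + t *: (y - p).
  by apply/rowP => i; rewrite !mxE; ring.
rewrite (le_trans (ler_normD _ _))// !normrZ.
have r0 : 0 <= r by apply: le_trans hx.
have h1 : `|1 - t| * `|x - p| <= 3 * r.
  apply: ler_pM => //; rewrite (le_trans (ler_normB _ _))// normr1; lra.
have h2 : `|t| * `|y - p| <= 2 * r by apply: ler_pM => //; exact: ltW.
lra.
Qed.

Lemma Ck_le1 (V W : normedModType R) k (U : set V) (f : V -> W) : Ck k.+1 U f -> Ck 1 U f.
Proof.
case=> cf df; split=> // v; have [dv Dv] := df v; split=> //.
by case: k Dv {df} => [|k] //= [].
Qed.

Lemma Ck_derive (V W : normedModType R) k (U : set V) (f : V -> W) v :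
  Ck k.+1 U f -> Ck k U ('D_v f).
Proof. by case=> _ /(_ v)[]. Qed.

Lemma right_inverse_of_surjective n k (A : 'M[R]_(n, k)) :
  (forall w : 'rV[R]_k, exists v : 'rV[R]_n, v *m A = w) ->
  exists P : 'M[R]_(k, n), P *m A = 1%:M.
Proof.
move=> sA; have /choice[v Hv] : forall i : 'I_k, exists v : 'rV[R]_n, v *m A = delta_mx ord0 i.
  by move=> i; exact: sA.
exists (\matrix_i v i); apply/row_matrixP => i.
by rewrite row_mul rowK Hv row1.
Qed.

Lemma open_norm_lt2 : open [set t : R | `|t| < 2].
Proof.
rewrite (_ : [set t | _] = ball (0 : R) 2); first exact: ball_open.
by apply/seteqP; split=> t; rewrite /ball/= sub0r normrN.
Qed.

Lemma Rint01_norm2 : @Rint01 R `<=` [set t | `|t| < 2].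
Proof. by move=> t /= /andP[t0 t1]; rewrite ger0_norm// (le_lt_trans t1)// (_ : 1 = 1%:R)// ltr_nat. Qed.

(** The chord is corrected inside the range of [P]. The velocity of the correction is controlled by
    [h *m J (gam t)], which is of order [|h| ^+ 2]: [Phi] vanishes at both [x] and [x'], and its
    derivative is Lipschitz near [p] because [Phi] is C^2. *)
Lemma submanifold_chord_curve n (M : set 'rV[R]_n) p : embedded_submanifold3 M -> M p ->
  exists2 rho : R, 0 < rho & exists2 K : R, 0 < K & forall x x', M x -> M x' ->
    `|x - p| < rho -> `|x' - p| < rho ->
    exists2 gam, C1_curve_in M x x' gam &
      forall t, Rint01 t -> `|'D_1 gam t - (x' - x)| <= K * `|x' - x| ^+ 2.
Proof.
move=> subM Mp; have [k [U [Phi [oU Up PhiC surj PhiM]]]] := subM _ Mp.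
have PhiC1 : Ck 1 U Phi := Ck_le1 PhiC.
pose J := jac Phi.
have PhiJ x : U x -> sdiff Phi (J x) x by move=> Ux; exact: Ck1_sdiff oU PhiC1 Ux.
have [P PJ] : exists P : 'M[R]_(k, n), P *m J p = 1%:M.
  apply: right_inverse_of_surjective => w; have [v <-] := surj w; exists v.
  by have [_ ->] := sdiff_is_derive v (PhiJ _ Up).
have [KP KP0 PK] := mulmx_bounded P.
have /nbhs_normP[d1 /= d10 H1] : nbhs p U by exact: open_nbhs_nbhs.
have ballU z : `|z - p| < d1 -> U z by move=> h; apply: H1; rewrite /= distrC.
(* One number [d] encodes both a radius and the Lipschitz constant [d^-1], so that shrinking it
   weakens the property and [fin_uniform] applies. *)
have [d2 d20 JL] : exists2 d : R, 0 < d & forall i : 'I_n, forall y z,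
    `|y - p| < d -> `|z - p| < d ->
    `|'D_(delta_mx ord0 i) Phi z - 'D_(delta_mx ord0 i) Phi y| <= d^-1 * `|z - y|.
  apply: (@fin_uniform _ (fun i d => forall y z, `|y - p| < d -> `|z - p| < d ->
    `|'D_(delta_mx ord0 i) Phi z - 'D_(delta_mx ord0 i) Phi y| <= d^-1 * `|z - y|)).
    move=> i d d' d'0 dd' H y z hy hz; apply: le_trans (H _ _ _ _) _.
    - exact: lt_le_trans dd'.
    - exact: lt_le_trans dd'.
    - by rewrite ler_wpM2r// lef_pV2// posrE// (lt_le_trans d'0).
  move=> i; have D2 := Ck_le1 (Ck_derive (delta_mx ord0 i) PhiC).
  have [d d0 [L L0 H]] := sdiff_lipschitz (Ck1_sdiff oU D2 Up).
  exists (Num.min d L^-1); first by rewrite lt_min d0 invr_gt0.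
  move=> y z; rewrite !lt_min => /andP[y1 _] /andP[z1 _].
  rewrite (le_trans (H _ _ y1 z1))// ler_wpM2r//.
  rewrite -[leLHS]invrK lef_pV2 ?posrE ?invr_gt0 ?lt_min ?d0 ?invr_gt0//.
  by rewrite ge_min lexx orbT.
have [d3 d30 [L L0 PhiL]] := sdiff_lipschitz (PhiJ _ Up).
have Phip : Phi p = 0 by apply/(PhiM _ Up).
have [||rho1 rho10 IC] := @implicit_curve R n k Phi J p P d1 d10 _ Phip.
- by move=> x /ballU; exact: PhiJ.
- by move=> s; rewrite -mulmxA PJ mulmx1 subrr normr0 mulr_ge0.
pose K1 := 2 + KP * (4 * L); have K10 : 0 < K1 by rewrite addr_gt0// !mulr_gt0.
(* [c * rho] has to bound the distance to [p] of the chord for [|t| < 2] and of every point within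
   [(K1 + 1) * |h|] of the curve, where [|h| <= 2 * rho]. *)
pose c := 5 + 4 * K1.
have c0 : 0 < c by rewrite addr_gt0// mulr_gt0.
pose rho := Num.min (Num.min rho1 d3) (Num.min d1 d2) / c.
pose K := KP * (2 * (n.+1%:R * (d2^-1 * (K1 + 1)))).
have K0 : 0 < K by rewrite !mulr_gt0// ?invr_gt0// addr_gt0.
have rho0 : 0 < rho by rewrite divr_gt0// !lt_min rho10 d30 d10.
exists rho => //; exists K => // x x' Mx Mx' hx hx'.
have [rr1 rr2 rr3 rr4] : [/\ c * rho <= rho1, c * rho <= d3, c * rho <= d1 & c * rho <= d2].
  by rewrite /rho mulrC divfK ?gt_eqF// !ge_min !lexx ?orbT.
have r5 : 5 * rho <= c * rho by rewrite ler_pM2r// lerDl mulr_ge0// ltW.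
have r1 : rho < c * rho.
  have Kr : 0 < K1 * rho := mulr_gt0 K10 rho0.
  rewrite /c; lra.
pose h := x' - x.
have hrho : `|h| <= 2 * rho.
  by have := ler_distD p x' x; rewrite [`|p - x|]distrC -/h; lra.
have Ux : U x by apply: ballU; lra.
have Ux' : U x' by apply: ballU; lra.
have Px : Phi x = 0 by apply/(PhiM _ Ux).
have Px' : Phi x' = 0 by apply/(PhiM _ Ux').
pose r := Num.max `|x - p| `|x' - p|.
have rr : r < rho by rewrite gt_max hx.
have r0 : 0 <= r by rewrite le_max normr_ge0.
have bnear t : `|t| < 2 -> `|x + t *: h - p| <= 5 * r.
  by move=> t2; apply: interp_sub_norm => //; rewrite le_max lexx ?orbT.
have [|t /= t2|s [s' Hs]] := IC [set t | `|t| < 2] (fun t => x + t *: h) (fun=> h) open_norm_lt2.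
- move=> t /bnear; lra.
- exact: sdiff1_affine.
pose gam t := x + t *: h + s t *m P.
have sle t : `|t| < 2 -> `|s t| <= 4 * L * `|h|.
  move=> t2; have [_ _ + _ _] := Hs t t2; move/le_trans; apply.
  have := PhiL x (x + t *: h).
  rewrite Px subr0 [_ + _ - x]addrAC subrr add0r normrZ => E.
  have hxd : `|x - p| < d3 by lra.
  have htd : `|x + t *: h - p| < d3 by have := bnear _ t2; lra.
  have {}E := E hxd htd.
  have : L * (`|t| * `|h|) <= L * (2 * `|h|) by rewrite ler_pM2l// ler_wpM2r// ltW.
  lra.
have gx t : `|t| < 2 -> `|gam t - x| <= K1 * `|h|.
  move=> t2; have -> : gam t - x = t *: h + s t *m P.
    by rewrite /gam addrAC [x + _]addrC addrK.
  rewrite (le_trans (ler_normD _ _))// mulrDl lerD//.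
    by rewrite normrZ ler_wpM2r// ltW.
  by rewrite (le_trans (PK _))// -mulrA ler_pM2l// sle.
have gE t : `|t| < 2 -> sdiff1 gam (h + s' t *m P) t.
  move=> t2; apply: sdiff1D; first exact: sdiff1_affine.
  by apply: sdiff1_mulmx; have [] := Hs t t2.
have [gC gD] := sdiff1_Ck1 open_norm_lt2 gE.
have s0 t : `|t| < 2 -> Phi (x + t *: h) = 0 -> s t = 0.
  move=> t2 P0; have [_ _ + _ _] := Hs t t2.
  by rewrite P0 normr0 mulr0 normr_le0 => /eqP.
exists gam; first (exists [set t | `|t| < 2]; split; [exact: open_norm_lt2|split; [exact: Rint01_norm2|split; [exact: gC|split]]]).
- move=> t /Rint01_norm2 t2; have [_ P0 _ _ /ballU Ug] := Hs t t2.
  by apply/(PhiM _ Ug).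
- split.
    by rewrite /gam s0 ?scale0r ?addr0 ?mul0mx ?addr0// normr0.
  rewrite /gam s0 ?scale1r ?mul0mx ?addr0 /h ?[x + _]addrC ?subrK//.
  by rewrite normr1 (_ : 1 = 1%:R)// ltr_nat.
move=> t /Rint01_norm2 t2; rewrite gD// -/h [h + _]addrC addrK.
have [_ _ _ Hs' gp] := Hs t t2; rewrite -/(gam t) in Hs' gp.
pose q := (K1 + 1) * `|h|.
have q0 : 0 <= q by rewrite mulr_ge0// addr_ge0// ltW.
have qx : `|x - gam t| <= q.
  by rewrite distrC (le_trans (gx _ t2))// ler_wpM2r// lerDl.
have qx' : `|x' - gam t| <= q.
  have := ler_distD x x' (gam t); rewrite -/h [`|x - _|]distrC.
  by have := gx _ t2; rewrite /q; lra.
have K1h : K1 * `|h| <= K1 * (2 * rho) by rewrite ler_pM2l.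
have gd : `|gam t - p| < d2.
  have := ler_distD x (gam t) p; have := gx _ t2.
  move: rr4; rewrite /c mulrDl; lra.
have zd z : `|z - gam t| <= q -> `|z - p| < c * rho.
  move=> zq; have := ler_distD (gam t) z p; have := ler_distD x (gam t) p; have := gx _ t2.
  move: zq; rewrite /q /c; lra.
(* The estimate is centred at [gam t], on a ball containing both endpoints, where the partial
   derivatives of [Phi] vary by at most [d2^-1 * q]. *)
have := @coord_mvt R n k Phi (J (gam t)) (gam t) q (d2^-1 * q) _ _ x x' qx qx'.
rewrite Px Px' subrr sub0r normrN -/h => E.
have {}E : `|h *m J (gam t)| <= n%:R * (d2^-1 * q) * `|h|.
  apply: E; first by rewrite mulr_ge0// invr_ge0 ltW.
  move=> z zq i; have zcr := zd _ zq.
  have Uz : U z by apply: ballU; exact: lt_le_trans rr3.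
  split; first by have [_ /(_ (delta_mx ord0 i))[+ _]] := PhiC; apply.
  have -> : row i (J (gam t)) = 'D_(delta_mx ord0 i) Phi (gam t).
    by apply/rowP => j; rewrite !mxE.
  apply: (le_trans (JL i _ _ gd _)); first exact: lt_le_trans rr4.
  by rewrite ler_wpM2l// invr_ge0 ltW.
rewrite (le_trans (PK _))// /K -[leRHS]mulrA ler_pM2l// (le_trans Hs')//.
rewrite -[leRHS]mulrA ler_pM2l// (le_trans E)//.
have -> : n%:R * (d2^-1 * q) * `|h| = n%:R * ((d2^-1 * (K1 + 1)) * `|h| ^+ 2) by rewrite /q; ring.
rewrite -[leRHS]mulrA ler_wpM2r ?ler_nat// mulr_ge0 ?sqr_ge0// ltW//.
by rewrite mulr_gt0 ?invr_gt0// addr_gt0.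
Qed.

Lemma dM_le_chord n (M : set 'rV[R]_n) p : embedded_submanifold3 M -> M p ->
  exists2 rho : R, 0 < rho & exists2 K : R, 0 < K & forall x x', M x -> M x' ->
    `|x - p| < rho -> `|x' - p| < rho ->
    (dM M x x' <= (enorm (x' - x) + K * enorm (x' - x) ^+ 2)%:E)%E.
Proof.
move=> subM Mp; have [rho rho0 [K K0 H]] := submanifold_chord_curve subM Mp.
exists rho => //; exists (n.+1%:R * K) => [|x x' Mx Mx' hx hx']; first by rewrite mulr_gt0.
have [gam gamC Hg] := H _ _ Mx Mx' hx hx'.
apply: (dM_le gamC) => t It; rewrite -['D_1 gam t](subrK (x' - x)).
rewrite (le_trans (enormD _ _))// addrC lerD2l (le_trans (enorm_le_norm _))// -mulrA.
apply: ler_pM => //; first by rewrite ler_nat.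
rewrite (le_trans (Hg _ It))// ler_pM2l//.
by rewrite ler_pXn2r ?nnegrE ?enorm_ge0 ?norm_le_enorm.
Qed.

End ChordCurves.

(** * Derivatives of averaging maps, by dyadic subdivision *)

Section AveragingMaps.
Variables (R : realType) (n : nat) (g : R -> 'rV[R]_n) (L K beta : R).
Hypothesis L0 : 0 <= L.
Hypothesis K0 : 0 <= K.
Hypothesis beta0 : 0 <= beta.
Hypothesis betaK : 2 * K * L <= beta ^+ 2.
Hypothesis g_upper : forall a b, Rint01 a -> Rint01 b ->
  enorm (g b - g a) <= `|b - a| * L.
Hypothesis g_lower : forall a b, Rint01 a -> Rint01 b ->
  `|b - a| * L <= enorm (g b - g a) + K * enorm (g b - g a) ^+ 2.

(* The parallelogram law turns the almost maximal length of the chord of [a, b]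
   into the almost equality of its two half chords. *)
Lemma half_chords a l : 0 < l -> Rint01 a -> Rint01 (a + l) ->
  enorm ((g (a + l / 2) - g a) - (g (a + l) - g (a + l / 2))) ^+ 2
    <= 2 * K * (l * L) ^+ 3.
Proof.
move=> l0 Ia Ial.
have Im : Rint01 (a + l / 2).
  move: Ia Ial; rewrite /Rint01/= => /andP[? ?] /andP[? ?]; apply/andP; split; lra.
set u := g (a + l / 2) - g a; set v := g (a + l) - g (a + l / 2).
have uv : u + v = g (a + l) - g a by rewrite /u /v addrC addrA subrK.
have e1 : `|a + l - a| = l by rewrite addrAC subrr add0r gtr0_norm.
have e2 : `|a + l / 2 - a| = l / 2 by rewrite addrAC subrr add0r gtr0_norm// divr_gt0.
have e3 : `|a + l - (a + l / 2)| = l / 2.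
  have -> : a + l - (a + l / 2) = l / 2 by field.
  by rewrite gtr0_norm// divr_gt0.
have hu := g_upper Ia Im; rewrite e2 -/u in hu.
have hv := g_upper Im Ial; rewrite e3 -/v in hv.
have huv := g_upper Ia Ial; rewrite e1 -uv in huv.
have hl := g_lower Ia Ial; rewrite e1 -uv in hl.
have := parallelogram u v.
move: hu hv huv hl (enorm_ge0 u) (enorm_ge0 v) (enorm_ge0 (u + v)) => /=.
rewrite [l / 2 * L]mulrAC.
have x0 : 0 <= l * L by rewrite mulr_ge0// ltW.
move: (enorm u) (enorm v) (enorm (u + v)) (enorm (u - v)) (l * L) x0 => p q d w x x0.
move=> hp hq hd hl p0 q0 d0 E.
have pp : p ^+ 2 <= (x / 2) ^+ 2 by rewrite ler_pXn2r// nnegrE divr_ge0.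
have qq : q ^+ 2 <= (x / 2) ^+ 2 by rewrite ler_pXn2r// nnegrE divr_ge0.
have w2 : w ^+ 2 <= x ^+ 2 - d ^+ 2 by lra.
have dd : d ^+ 2 <= x ^+ 2 by rewrite ler_pXn2r// nnegrE.
have xd : x - d <= K * x ^+ 2.
  by rewrite lerBlDr addrC (le_trans hl)// lerD2l ler_wpM2l.
apply: (le_trans w2); rewrite subr_sqr.
have -> : 2 * K * x ^+ 3 = (K * x ^+ 2) * (2 * x) by ring.
by apply: ler_pM => //; rewrite ?subr_ge0 ?addr_ge0//; lra.
Qed.

(** Either half slope differs from [s] by [l^-1] times the difference of the half chords, up to
    sign. The square of this is at most [beta ^+ 2 * L ^+ 2 * 2^-1 ^+ k], and 3/4 is a rational
    majorant of the square root of 1/2. *)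
Lemma half_slopes a k : Rint01 a -> Rint01 (a + 2^-1 ^+ k) ->
  let l := 2^-1 ^+ k in let l' := 2^-1 ^+ k.+1 in
  let s := l^-1 *: (g (a + l) - g a) in
  enorm (l'^-1 *: (g (a + l') - g a) - s) <= beta * L * (3 / 4) ^+ k /\
  enorm (l'^-1 *: (g (a + l) - g (a + l')) - s) <= beta * L * (3 / 4) ^+ k.
Proof.
move=> Ia Ial l l' s.
have l0 : 0 < l by rewrite exprn_gt0// invr_gt0.
have l'E : l' = l / 2 by rewrite /l' exprSr.
have H := half_chords l0 Ia Ial; rewrite -l'E in H.
set w := (_ - _) in H.
have lw : enorm (l^-1 *: w) <= beta * L * (3 / 4) ^+ k.
  rewrite enormZ gtr0_norm ?invr_gt0// -(@ler_pXn2r _ 2)// ?nnegrE; last 2 first.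
  - by rewrite mulr_ge0 ?enorm_ge0// invr_ge0 ltW.
  - by rewrite !mulr_ge0// exprn_ge0// divr_ge0.
  rewrite exprMn.
  apply: (@le_trans _ _ (l^-1 ^+ 2 * (2 * K * (l * L) ^+ 3))).
    by rewrite ler_wpM2l// sqr_ge0.
  have -> : l^-1 ^+ 2 * (2 * K * (l * L) ^+ 3) = (2 * K * L) * (L ^+ 2 * l).
    by field; rewrite gt_eqF.
  have -> : (beta * L * (3 / 4) ^+ k) ^+ 2 = beta ^+ 2 * (L ^+ 2 * ((3 / 4) ^+ 2) ^+ k).
    by rewrite -exprM mulnC exprM; ring.
  apply: ler_pM => //; first by rewrite !mulr_ge0.
    by rewrite mulr_ge0 ?sqr_ge0// ltW.
  rewrite ler_wpM2l ?sqr_ge0//; apply: lerXn2r; rewrite ?nnegrE; lra.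
have l'i : l'^-1 = 2 * l^-1 by rewrite l'E; field; rewrite gt_eqF.
split.
  suff -> : l'^-1 *: (g (a + l') - g a) - s = l^-1 *: w by [].
  by rewrite l'i /s /w; apply/rowP => i; rewrite !mxE; ring.
suff -> : l'^-1 *: (g (a + l) - g (a + l')) - s = - (l^-1 *: w) by rewrite enormN.
by rewrite l'i /s /w; apply/rowP => i; rewrite !mxE; ring.
Qed.

(** At each step the half containing [t] is kept; the errors [beta * L * (3 / 4) ^+ i] for [i < k]
    add up to the stated bound. *)
Lemma dyadic_slopes t k : Rint01 t -> exists a, [/\ 0 <= a, a <= t,
  t <= a + 2^-1 ^+ k, a + 2^-1 ^+ k <= 1 &
  enorm ((2^-1 ^+ k)^-1 *: (g (a + 2^-1 ^+ k) - g a) - (g 1 - g 0))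
    <= 4 * beta * L * (1 - (3 / 4) ^+ k)].
Proof.
move=> /= /andP[t0 t1]; elim: k => [|k [a [a0 at_ ta a1 IH]]].
  exists 0; rewrite !expr0 add0r invr1 scale1r subrr enorm0 subrr mulr0.
  by split.
have l0 : 0 < 2^-1 ^+ k :> R by rewrite exprn_gt0// invr_gt0.
have l'E : 2^-1 ^+ k.+1 = 2^-1 ^+ k / 2 :> R by rewrite exprSr.
have Ia : Rint01 a by rewrite /Rint01/=; apply/andP; split; lra.
have Ial : Rint01 (a + 2^-1 ^+ k) by rewrite /Rint01/=; apply/andP; split; lra.
have [S1 S2] := half_slopes Ia Ial.
have bound s : enorm (s - (2^-1 ^+ k)^-1 *: (g (a + 2^-1 ^+ k) - g a)) <=
    beta * L * (3 / 4) ^+ k ->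
    enorm (s - (g 1 - g 0)) <= 4 * beta * L * (1 - (3 / 4) ^+ k.+1).
  move=> Hs; apply: (le_trans (enorm_triangle _ _ _)); apply: (le_trans (lerD Hs IH)).
  rewrite exprSr; lra.
have [tm|tm] := leP t (a + 2^-1 ^+ k.+1).
  by exists a; split=> //; [rewrite l'E; lra|exact: bound].
have E : a + 2^-1 ^+ k.+1 + 2^-1 ^+ k.+1 = a + 2^-1 ^+ k by rewrite l'E; field.
exists (a + 2^-1 ^+ k.+1); rewrite E; split=> //; [rewrite l'E; lra|exact: ltW|].
exact: bound.
Qed.

(** The dyadic intervals have [t] between their ends, so their slopes converge to any derivative at
    [t], one-sided when [t] is 0 or 1. *)
Lemma averaging_deriv_close t w : Rint01 t -> has_deriv01 g t w ->
  enorm (w - (g 1 - g 0)) <= 4 * beta * L.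
Proof.
move=> It gw; apply/ler_addgt0Pr => e e0.
pose e' := e / n.+1%:R; have e'0 : 0 < e' by rewrite divr_gt0.
have [d d0 Hd] : exists2 d : R, 0 < d & forall b, Rint01 b -> `|b - t| < d ->
    `|g b - g t - (b - t) *: w| <= e' * `|b - t|.
  have /cvgrPdist_le/(_ _ e'0) := gw.
  rewrite near_withinE => /nbhs_normP[d /= d0 H]; exists d => // b Ib bt.
  have [->|bt0] := eqVneq b t; first by rewrite !subrr scale0r subrr !normr0 mulr0.
  have h0 : b - t != 0 by rewrite subr_eq0.
  have := H (b - t); rewrite /= sub0r normrN [t + _]addrC subrK => /(_ bt (conj h0 Ib)).
  rewrite mulrC -(ler_pM2l (_ : 0 < `|b - t|)) ?normr_gt0//; apply: le_trans.
  rewrite -normrZ le_eqVlt; apply/orP; left; apply/eqP.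
  rewrite -normrN; congr (`|_|).
  by apply/rowP => i; rewrite !mxE; field.
have [k lk] : exists k, 2^-1 ^+ k < d.
  have [k _ /(_ k (leqnn k))] := near_infty_natSinv_expn_lt (PosNum d0).
  by rewrite /= mul1r -exprVn => ?; exists k.
have [a [a0 at_ ta a1 Hs]] := dyadic_slopes k It.
move: lk a1 ta Hs; set l := 2^-1 ^+ k => lk a1 ta Hs.
have l0 : 0 < l by rewrite exprn_gt0// invr_gt0.
have [t0 t1] := andP It.
have Ia : Rint01 a by rewrite /Rint01/=; apply/andP; split; lra.
have Ial : Rint01 (a + l) by rewrite /Rint01/=; apply/andP; split; lra.
have na : `|a - t| = t - a by rewrite distrC ger0_norm// subr_ge0.
have nal : `|a + l - t| = a + l - t by rewrite ger0_norm// subr_ge0.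
have E1 := Hd _ Ia; rewrite na in E1.
have E2 := Hd _ Ial; rewrite nal in E2.
have {}E1 := E1 (_ : t - a < d); have {}E2 := E2 (_ : a + l - t < d).
have {}E1 : `|g a - g t - (a - t) *: w| <= e' * (t - a) by apply: E1; lra.
have {}E2 : `|g (a + l) - g t - (a + l - t) *: w| <= e' * (a + l - t) by apply: E2; lra.
(* Since [a <= t <= a + l], the errors [e' * (t - a)] and [e' * (a + l - t)] add up to exactly
   [e' * l]. *)
have E : `|w - l^-1 *: (g (a + l) - g a)| <= e'.
  rewrite -(ler_pM2l l0).
  have -> : l * `|w - l^-1 *: (g (a + l) - g a)| =
     `|(g a - g t - (a - t) *: w) - (g (a + l) - g t - (a + l - t) *: w)|.
    rewrite -[X in X * _ = _](gtr0_norm l0) -normrZ; congr (`|_|).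
    by apply/rowP => i; rewrite !mxE; field; rewrite gt_eqF.
  rewrite (le_trans (ler_normB _ _))// (le_trans (lerD E1 E2))//; lra.
apply: (le_trans (enorm_triangle _ (l^-1 *: (g (a + l) - g a)) _)).
rewrite addrC lerD//.
  apply: (le_trans Hs); rewrite ler_piMr ?mulr_ge0//.
rewrite (le_trans (enorm_le_norm _))//.
apply: (@le_trans _ _ (n%:R * e')); first by rewrite ler_wpM2l.
by rewrite /e' mulrCA ler_piMr ?ltW// ltr_pdivrMr// mul1r ltr_nat.
Qed.

End AveragingMaps.

(** * Dense cones and convex combinations *)

Section Convexity.
Variable R : realType.

Lemma closure_normP m (S : set 'rV[R]_m) (p : 'rV[R]_m) :
  closure S p <-> forall e : R, 0 < e -> exists2 s, S s & `|p - s| < e.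
Proof.
split=> [Sp e e0|H B /nbhs_normP[e /= e0 eB]].
  have /Sp[s [Ss]] : nbhs p (ball p e) by exact: nbhsx_ballx.
  by rewrite -ball_normE => ps; exists s.
by have [s Ss ps] := H _ e0; exists s; split=> //; apply: eB.
Qed.

(* Otherwise the difference between a point and its projection on the closure
   of the cone would be a nonzero element of the dual cone. *)
Lemma cone_dense m (S : set 'rV[R]_m) :
  S 0 -> (forall u v, S u -> S v -> S (u + v)) ->
  (forall (a : R) u, 0 <= a -> S u -> S (a *: u)) ->
  (forall y, (forall s, S s -> 0 <= dotv y s) -> y = 0) ->
  forall w (e : R), 0 < e -> exists2 s, S s & `|w - s| < e.
Proof.
move=> S0 SD SZ dualS w; apply/closure_normP.
have cl0 : closure S 0 by exact: subset_closure.
(* Truncation gives compactness; points of norm above [2 * enorm w] are no closer to [w] than 0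
   is. *)
pose A := closure S `&` [set s | `|s| <= 2 * enorm w].
have A0 : A 0 by split=> //=; rewrite normr0 mulr_ge0// enorm_ge0.
have [||x|x y _ _|c Ac cmin] := @lipschitz_attains_min _ _ A (fun s => enorm (s - w)) m%:R (2 * enorm w).
- by exists 0.
- by apply: closedI; [exact: closed_closure|exact: norm_le_closed].
- by case.
- apply: (le_trans (enorm_lipschitz _ _)); rewrite opprB addrA subrK//.
have {}cmin s : closure S s -> enorm (c - w) <= enorm (s - w).
  move=> cls; have [sw|sw] := leP `|s| (2 * enorm w); first by apply: cmin.
  have := cmin _ A0; rewrite sub0r enormN => /le_trans; apply.
  have := norm_le_enorm (s - w); have := norm_le_enorm w.
  have := lerB_dist s w; lra.
have clc s a : S s -> 0 <= a -> closure S (c + a *: s).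
  move=> Ss a0; apply/closure_normP => e e0.
  have [/closure_normP/(_ _ e0)[s' Ss' cs'] _] := Ac.
  exists (s' + a *: s); first by apply: SD => //; apply: SZ.
  by rewrite opprD addrACA subrr addr0.
have /eqP : c - w = 0.
  apply: dualS => s Ss; apply/ler_addgt0Pr => e e0.
  (* With [a * dotv s s <= e], minimality of [c] against [c + a *: s] becomes
     [0 <= a * (2 * dotv (c - w) s + e)]. *)
  pose a := e / (1 + dotv s s).
  have q0 : 0 < 1 + dotv s s by rewrite ltr_pwDl// dotv_ge0.
  have a0 : 0 < a by rewrite divr_gt0.
  have := cmin _ (clc _ _ Ss (ltW a0)).
  rewrite -(@ler_pXn2r _ 2)// ?nnegrE ?enorm_ge0// addrAC [enorm (c - w + _) ^+ 2]sqr_enormD dotvZr.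
  rewrite enormZ exprMn [enorm s ^+ 2]sqr_enorm [`|a|]gtr0_norm//.
  move: (dotv (c - w) s) (enorm _ ^+ 2) => Y X H.
  have sa : a * dotv s s <= e.
    by rewrite /a mulrAC ler_pdivrMr// ler_pM2l// lerDr.
  have : a * (a * dotv s s) <= a * e by rewrite ler_pM2l.
  move=> H2; have : 0 <= a * (2 * Y + e) by lra.
  by rewrite pmulr_rge0//; lra.
by rewrite subr_eq0 => /eqP <-; have [] := Ac.
Qed.

(** The weight missing from 1 is carried by [y]. In the induction the other weights are rescaled by
    the complement of the last one, or vanish if the last one is 1. *)
Lemma convex_comb m (D : set 'rV[R]_m) N (d : 'I_N -> 'rV[R]_m) (a : 'I_N -> R) y :
  convex_set_in D -> D y -> (forall j, D (d j)) -> (forall j, 0 <= a j) ->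
  \sum_j a j <= 1 -> D (y + \sum_j a j *: (d j - y)).
Proof.
move=> cD Dy; elim: N d a => [|N IH] d a Dd a0 a1; first by rewrite big_ord0 addr0.
rewrite !big_ord_recr/= in a1 *.
set b := a ord_max in a1 *; set e := d ord_max.
have S0 : 0 <= \sum_(i < N) a (widen_ord (leqnSn N) i) by apply: sumr_ge0.
have b0 : 0 <= b by exact: a0.
have b1 : b <= 1 by lra.
have [bE|bE] := eqVneq b 1.
  have : \sum_(i < N) a (widen_ord (leqnSn N) i) == 0 by rewrite eq_le S0 andbT; lra.
  rewrite psumr_eq0// => /allP az.
  rewrite big1 => [|i _]; last first.
    by have /(_ (mem_index_enum i)) /= /eqP -> := az i; rewrite scale0r.
  by rewrite bE add0r scale1r addrC subrK; exact: Dd.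
have b2 : 0 < 1 - b by rewrite subr_gt0 lt_def eq_sym bE.
have := IH (fun i => d (widen_ord (leqnSn N) i)) (fun i => a (widen_ord (leqnSn N) i) / (1 - b)).
move=> /(_ (fun=> Dd _)) H.
have {}H : D (y + \sum_(i < N) (a (widen_ord (leqnSn N) i) / (1 - b)) *: (d (widen_ord (leqnSn N) i) - y)).
  apply: H; first by move=> i; rewrite divr_ge0// ltW.
  by rewrite -mulr_suml ler_pdivrMr// mul1r; lra.
have := cD _ _ b H (Dd ord_max); rewrite b0 b1 => /(_ isT).
congr (D _); rewrite -/e scalerDr scaler_sumr.
rewrite (eq_bigr (fun i => a (widen_ord (leqnSn N) i) *: (d (widen_ord (leqnSn N) i) - y))); last first.
  by move=> i _; rewrite scalerA mulrCA divff ?gt_eqF// mulr1.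
by move: (\sum_(i < N) _) => X; apply/rowP => i; rewrite !mxE; ring.
Qed.

End Convexity.

(** * Bumped chords corrected into a zero set *)

(** [A] nearly kills [z' - z], so the residual is at most [2 * e * |z' - z|] times [t], and also
    times [1 - t]. Averaging these bounds with weights [1 - t] and [t] gives the profile of the
    bump. *)
Lemma chord_defect (R : realType) a m (f : 'rV[R]_a -> 'rV[R]_m) (A : 'M[R]_(a, m))
    (p z z' : 'rV[R]_a) (d e t : R) : 0 <= e ->
  (forall x y, `|x - p| < d -> `|y - p| < d ->
     `|f y - f x - (y - x) *m A| <= e * `|y - x|) ->
  `|z - p| < d -> `|z' - p| < d -> f z = 0 -> f z' = 0 -> 0 <= t <= 1 ->
  `|f (z + t *: (z' - z))| <= 4 * e * `|z' - z| * (t * (1 - t)).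
Proof.
move=> e0 fA hz hz' fz fz' /andP[t0 t1].
have ht : `|z + t *: (z' - z) - p| < d.
  have -> : z + t *: (z' - z) - p = (1 - t) *: (z - p) + t *: (z' - p).
    by apply/rowP => i; rewrite !mxE; ring.
  rewrite (le_lt_trans (ler_normD _ _))// !normrZ (ger0_norm t0) ger0_norm ?subr_ge0//.
  have h1 : (1 - t) * `|z - p| <= (1 - t) * Num.max `|z - p| `|z' - p|.
    by rewrite ler_wpM2l ?subr_ge0// le_max lexx.
  have h2 : t * `|z' - p| <= t * Num.max `|z - p| `|z' - p|.
    by rewrite ler_wpM2l// le_max lexx orbT.
  have : Num.max `|z - p| `|z' - p| < d by rewrite gt_max hz.
  lra.
have hA : `|(z' - z) *m A| <= e * `|z' - z|.
  by have := fA _ _ hz hz'; rewrite fz fz' subrr sub0r normrN.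
have E1 := fA _ _ hz ht; rewrite fz subr0 in E1.
have E2 := fA _ _ hz' ht; rewrite fz' subr0 in E2.
have d1 : z + t *: (z' - z) - z = t *: (z' - z) by rewrite addrAC subrr add0r.
have d2 : z + t *: (z' - z) - z' = - ((1 - t) *: (z' - z)).
  by apply/rowP => i; rewrite !mxE; ring.
rewrite d1 -scalemxAl normrZ (ger0_norm t0) in E1.
rewrite d2 mulNmx -scalemxAl opprK normrN normrZ ger0_norm ?subr_ge0// in E2.
set F := f _ in E1 E2 *; set X := (z' - z) *m A in hA E1 E2.
set h := `|z' - z| in hA E1 E2 *.
have F1 : `|F| <= 2 * e * h * t.
  have := ler_normD (F - t *: X) (t *: X); rewrite subrK normrZ ger0_norm//.
  have : t * `|X| <= t * (e * h) by rewrite ler_wpM2l.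
  lra.
have F2 : `|F| <= 2 * e * h * (1 - t).
  have := ler_normB (F + (1 - t) *: X) ((1 - t) *: X); rewrite addrK normrZ ger0_norm ?subr_ge0//.
  have : (1 - t) * `|X| <= (1 - t) * (e * h) by rewrite ler_wpM2l ?subr_ge0.
  lra.
have t1' : 0 <= 1 - t by rewrite subr_ge0.
have : t * `|F| <= t * (2 * e * h * (1 - t)) by rewrite ler_wpM2l.
have : (1 - t) * `|F| <= (1 - t) * (2 * e * h * t) by rewrite ler_wpM2l.
lra.
Qed.

(** [v] is the direction of the bump, almost in the kernel of the derivative. The point of the
    conclusion is [|s t| <= k * (t * (1 - t))]: the correction never exceeds the bump. [C] is fixed
    before [e1], so the height of the bump can be adapted to it. *)
Lemma bumped_chord_curve (R : realType) a m (f : 'rV[R]_a -> 'rV[R]_m)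
    (J : 'rV[R]_a -> 'M[R]_(a, m)) (p : 'rV[R]_a) (dU : R) (P : 'M[R]_(m, a))
    (v : 'rV[R]_a) : 0 < dU ->
  (forall x, `|x - p| < dU -> sdiff f (J x) x) -> f p = 0 ->
  (forall s : 'rV_m, `|s *m P *m J p - s| <= 4^-1 * `|s|) -> `|v *m J p| <= 4^-1 ->
  exists2 C : R, 0 < C & forall e1 d1 : R, 0 < e1 -> 0 < d1 ->
  exists2 rho : R, 0 < rho & forall z z', `|z - p| < rho -> `|z' - p| < rho ->
    f z = 0 -> f z' = 0 ->
    let k := e1 * `|z' - z| in
    exists s s' : R -> 'rV[R]_m,
    let gam t := z + t *: (z' - z) + (k * (t * (1 - t))) *: v + s t *m P in
    let gam' t := z' - z + (k * (1 - 2 * t)) *: v + s' t *m P in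
    [/\ forall t, `|t| < 2 -> sdiff1 gam (gam' t) t,
        s 0 = 0, s 1 = 0 &
        forall t, Rint01 t -> [/\ f (gam t) = 0, `|gam t - p| < d1,
          `|s t| <= k * (t * (1 - t)) &
          `|gam' t - (z' - z)| <= C * e1 * `|z' - z| ]].
Proof.
move=> dU0 fJ fp PJ vJ.
have [KP KP0 PK] := mulmx_bounded P.
have [rho1 rho10 IC] := implicit_curve dU0 fJ fp PJ.
exists (`|v| + 2 * KP); first by rewrite ltr_wpDl// mulr_gt0.
move=> e1 d1 e10 d10.
(* In units of [k * (t * (1 - t))], the residual of the bumped chord is at most 1/8 for the chord
   ([32 * e <= e1]), 1/8 for the nonlinearity along the bump and 1/4 for [vJ]. Its double, which
   bounds [s], is at most 1. *)
pose e := Num.min (e1 / 32) (8 * (1 + `|v|))^-1.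
have v1 : 0 < 1 + `|v| by rewrite ltr_pwDl.
have e0 : 0 < e by rewrite lt_min divr_gt0//= invr_gt0 mulr_gt0.
have ee1 : 32 * e <= e1.
  by rewrite mulrC -ler_pdivlMr// /e ge_min lexx.
have ev : 8 * (e * (1 + `|v|)) <= 1.
  have : e <= (8 * (1 + `|v|))^-1 by rewrite /e ge_min lexx orbT.
  by rewrite -[X in _ <= X]div1r ler_pdivlMr ?mulr_gt0//; lra.
have pp : `|p - p| < dU by rewrite subrr normr0.
have [d0 d00 fA] := fJ _ pp _ e0.
pose dm := Num.min (Num.min rho1 d0) (Num.min d1 dU).
have dm0 : 0 < dm by rewrite !lt_min rho10 d00 d10.
(* Room for the chord, for the bump ([|t * (1 - t)| <= 6] and [k <= 2 * rho * e1]) and for the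
   correction [s t *m P]. *)
pose c := 5 + 12 * e1 * `|v| + 2 * e1 * KP.
have e1v : 0 <= e1 * `|v| by rewrite mulr_ge0// ltW.
have e1K : 0 < e1 * KP by rewrite mulr_gt0.
have c0 : 0 < c by rewrite /c; lra.
pose rho := dm / c; have rho0 : 0 < rho by rewrite divr_gt0.
exists rho => // z z' hz hz' fz fz' k.
have crho : c * rho = dm by rewrite mulrC divfK// gt_eqF.
have c5 : 5 <= c by rewrite /c; lra.
have r1 : rho < dm.
  have : 5 * rho <= c * rho by rewrite ler_pM2r.
  lra.
have [m1 m2 m3 m4] : [/\ dm <= rho1, dm <= d0, dm <= d1 & dm <= dU].
  by rewrite !ge_min !lexx ?orbT.
set h := `|z' - z| in k *.
have h0 : 0 <= h by exact: normr_ge0.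
have hrho : h <= 2 * rho.
  by have := ler_distD p z' z; rewrite [`|p - z|]distrC -/h; lra.
have k0 : 0 <= k by rewrite mulr_ge0// ltW.
have kv : k * `|v| <= 2 * rho * (e1 * `|v|).
  by rewrite /k -mulrA mulrCA ler_wpM2r.
have kK : k * KP <= 2 * rho * (e1 * KP).
  by rewrite /k -mulrA mulrCA ler_pM2r.
have ev0 : 0 <= rho * (e1 * `|v|) by rewrite mulr_ge0// ltW.
have eK0 : 0 < rho * (e1 * KP) by rewrite mulr_gt0.
have dmE : dm = 5 * rho + 12 * (rho * (e1 * `|v|)) + 2 * (rho * (e1 * KP)).
  by rewrite -crho /c; ring.
pose r := Num.max `|z - p| `|z' - p|.
have rr : r < rho by rewrite gt_max hz.
have bnear t : `|t| < 2 -> `|z + t *: (z' - z) - p| <= 5 * r.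
  by move=> t2; apply: interp_sub_norm => //; rewrite le_max lexx ?orbT.
have kE : k = e1 * h by [].
have hk : 32 * (e * h) <= k by rewrite kE mulrA ler_wpM2r.
clearbody r rho c dm e k.
pose b t := z + t *: (z' - z) + (k * (t * (1 - t))) *: v.
pose b' t := z' - z + (k * (1 - 2 * t)) *: v.
have nb t q : `|t| < 2 -> `|t * (1 - t)| <= q -> `|b t - p| <= 5 * r + q * (k * `|v|).
  move=> t2 tq; rewrite /b addrAC (le_trans (ler_normD _ _))// lerD ?bnear//.
  rewrite normrZ normrM ger0_norm// mulrAC [q * _]mulrC ler_wpM2l// mulr_ge0//.
have [t /= t2|t /= t2|s [s' Hs]] := IC [set t | `|t| < 2] b b' (@open_norm_lt2 R).
- have := nb t 6 t2; rewrite normrM => H.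
  have {}H : `|b t - p| <= 5 * r + 6 * (k * `|v|).
    apply: H; rewrite (_ : 6 = 2 * 3)//; last by rewrite -natrM.
    apply: ler_pM => //; first exact: ltW.
    by rewrite (le_trans (ler_normB _ _))// normr1; clear -t2; lra.
  by clear -H rr dmE ev0 eK0 kv m1; lra.
- by apply: sdiff1D; [exact: sdiff1_affine|exact: sdiff1_quadratic].
exists s, s' => gam gam'.
have s0 t : `|t| < 2 -> f (b t) = 0 -> s t = 0.
  move=> t2 P0; have [_ _ + _ _] := Hs t t2.
  by rewrite P0 normr0 mulr0 normr_le0 => /eqP.
split.
- move=> t t2; apply: sdiff1D; last first.
    by apply: sdiff1_mulmx; have [] := Hs t t2.
  by apply: sdiff1D; [exact: sdiff1_affine|exact: sdiff1_quadratic].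
- by apply: s0; rewrite ?normr0// /b mul0r mulr0 !scale0r !addr0.
- apply: s0; first by rewrite normr1 (_ : 1 = 1%:R)// ltr_nat.
  by rewrite /b subrr !mulr0 scale0r addr0 scale1r addrC subrK.
move=> t It; have t2 := Rint01_norm2 It; have [t0 t1] := andP It.
have [_ fg sb s'b _] := Hs t t2.
have tt0 : 0 <= t * (1 - t) by rewrite mulr_ge0// subr_ge0.
have kt0 : 0 <= k * (t * (1 - t)) by exact: mulr_ge0.
have tt1 : t * (1 - t) <= 1.
  by apply: mulr_ile1 => //; rewrite ?subr_ge0// lerBlDr lerDl.
have fA' x y : `|x - p| < dm -> `|y - p| < dm ->
    `|f y - f x - (y - x) *m J p| <= e * `|y - x|.
  by move=> hx hy; apply: fA; exact: lt_le_trans m2.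
have ht : `|z + t *: (z' - z) - p| < dm.
  by have := bnear _ t2; clear -rr dmE ev0 eK0; lra.
have hb : `|b t - p| <= 5 * r + k * `|v|.
  by have := nb t 1 t2; rewrite mul1r ger0_norm//; apply.
have hb' : `|b t - p| < dm by clear -hb rr dmE ev0 eK0 kv; lra.
have def : `|f (z + t *: (z' - z))| <= 4 * e * h * (t * (1 - t)).
  by apply: (chord_defect (ltW e0) fA') => //; apply: lt_trans r1.
have fb : 2 * `|f (b t)| <= k * (t * (1 - t)).
  have := fA' _ _ ht hb'; rewrite {2}/b [_ + _ - (z + _)]addrAC subrr add0r.
  rewrite -scalemxAl [`|_ *: v|]normrZ (ger0_norm kt0).
  set Y := _ *: (v *m J p); set F := f (z + t *: (z' - z)) in def *.
  have YE : `|Y| <= k * (t * (1 - t)) * 4^-1.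
    by rewrite normrZ (ger0_norm kt0) ler_wpM2l.
  have := ler_normD (f (b t) - F - Y) (F + Y); rewrite -[_ - F - Y]addrA -opprD subrK.
  have := ler_normD F Y.
  have E1 : 4 * e * h * (t * (1 - t)) <= 8^-1 * (k * (t * (1 - t))).
    by have := ler_wpM2r tt0 hk; clear; lra.
  have E2 : e * (k * (t * (1 - t)) * `|v|) <= 8^-1 * (k * (t * (1 - t))).
    have -> : e * (k * (t * (1 - t)) * `|v|) = (e * `|v|) * (k * (t * (1 - t))) by ring.
    rewrite ler_wpM2r//.
    by move: ev; rewrite mulrDr mulr1; clear -e0; lra.
  by clear -E1 E2 def YE; lra.
have sk : `|s t| <= k * (t * (1 - t)) by exact: le_trans sb fb.
have sk' : `|s t *m P| <= k * KP.
  rewrite (le_trans (PK _))// mulrC ler_pM2r// (le_trans sk)//.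
  by rewrite ler_piMr.
have gp : `|gam t - p| < dm.
  have : `|gam t - p| <= `|b t - p| + `|s t *m P|.
    by rewrite /gam -/(b t) addrAC ler_normD.
  by clear -hb rr dmE ev0 eK0 kv kK sk'; lra.
split=> //; first exact: lt_le_trans gp m3.
have t12 : `|1 - 2 * t| <= 1.
  by clear -t0 t1; rewrite ler_norml; apply/andP; split; lra.
have zA : `|(z' - z) *m J p| <= e * h.
  have := fA' z z'; rewrite fz fz' subrr sub0r normrN; apply; exact: lt_trans r1.
have kt : `|k * (1 - 2 * t)| <= k by rewrite normrM ger0_norm// ler_piMr.
have b'n : `|b' t| <= h + k * `|v|.
  rewrite (le_trans (ler_normD _ _))// lerD2l normrZ ler_wpM2r//.
have b'A : `|b' t *m J p| <= e * h + k * 4^-1.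
  rewrite /b' mulmxDl (le_trans (ler_normD _ _))// lerD//.
  by rewrite -scalemxAl normrZ; apply: ler_pM.
have gU : `|gam t - p| < dU by exact: lt_le_trans gp m4.
have b'J : `|b' t *m J (gam t)| <= e * h + k * 4^-1 + e * (h + k * `|v|).
  have := sdiff_jac_close fA' gp (fJ _ gU) (b' t).
  have := ler_normD (b' t *m J (gam t) - b' t *m J p) (b' t *m J p).
  rewrite subrK; have : e * `|b' t| <= e * (h + k * `|v|) by rewrite ler_pM2l.
  by clear -b'A; lra.
have s'k : `|s' t| <= 2 * k.
  apply: (le_trans s'b); rewrite -/(b t) -/(gam t).
  have E1 : e * h <= 32^-1 * k by clear -hk; lra.
  have E2 : e * (k * `|v|) <= 8^-1 * k.
    rewrite mulrCA mulrC ler_wpM2r//; move: ev; rewrite mulrDr mulr1; clear -e0; lra.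
  by clear -b'J E1 E2 k0; lra.
have -> : gam' t - (z' - z) = (k * (1 - 2 * t)) *: v + s' t *m P.
  by rewrite /gam'; move: (s' t *m P) => W; apply/rowP => i; rewrite !mxE; ring.
rewrite (le_trans (ler_normD _ _))// normrZ.
have : `|k * (1 - 2 * t)| * `|v| <= k * `|v| by rewrite ler_wpM2r.
have : `|s' t *m P| <= KP * (2 * k) by rewrite (le_trans (PK _))// ler_pM2l.
by rewrite kE; clear; lra.
Qed.

(** * The lifted equation in the variables (x, l, y) *)

Section LiftedConstraint.
Variables (R : realType) (n N m : nat).
Variables (G : 'rV[R]_n -> 'rV[R]_m) (J : 'rV[R]_n -> 'M[R]_(n, m)).
Variables (Dm : 'M[R]_(N, m)) (tau : 'cV[R]_N).

(* The zero set of [lift_map] in the variables (x, l, y) is the equation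
   G x = y + sum_j l_j (Dm_j - tau_j y); when Dm_j = tau_j d_j with y, d_j in a
   convex set D and l >= 0 small, its right-hand side belongs to D. *)
Definition lift_map (z : 'rV[R]_(n + (N + m))) : 'rV[R]_m :=
  G (lsubmx z) - rsubmx (rsubmx z) - lsubmx (rsubmx z) *m Dm
  + lsubmx (rsubmx z) *m tau *m rsubmx (rsubmx z).

Definition lift_jac (z : 'rV[R]_(n + (N + m))) : 'M[R]_(n + (N + m), m) :=
  col_mx (J (lsubmx z)) (col_mx (tau *m rsubmx (rsubmx z) - Dm)
    (((lsubmx (rsubmx z) *m tau) ord0 ord0)%:M - 1%:M)).

Lemma mulmx11_norm (c : 'rV[R]_1) (y : 'rV[R]_m) : `|c *m y| <= `|c| * `|y|.
Proof.
by rewrite [c in c *m y]mx11_scalar mul_scalar_mx normrZ ler_wpM2r// le_rv_norm.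
Qed.

(** Besides [G], only the bilinear term [l *m tau *m y] is not affine; its remainder splits into two
    products of differences, each having one factor that is small near [z0]. *)
Lemma lift_sdiff z0 : sdiff G (J (lsubmx z0)) (lsubmx z0) -> sdiff lift_map (lift_jac z0) z0.
Proof.
move=> GJ e e0; have [K K0 tK] := mulmx_bounded tau.
have [|d1 d10 H1] := GJ (e / 2); first by rewrite divr_gt0.
exists (Num.min d1 (e / (4 * K))) => [|y z].
  by rewrite lt_min d10 divr_gt0// mulr_gt0.
rewrite !lt_min => /andP[y1 y2] /andP[z1 z2].
have sl (u w : 'rV[R]_(n + (N + m))) : lsubmx u - lsubmx w = lsubmx (u - w) by rewrite raddfB.
have sr (u w : 'rV[R]_(n + (N + m))) : rsubmx u - rsubmx w = rsubmx (u - w) by rewrite raddfB.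
have sl' (u w : 'rV[R]_(N + m)) : lsubmx u - lsubmx w = lsubmx (u - w) by rewrite raddfB.
have sr' (u w : 'rV[R]_(N + m)) : rsubmx u - rsubmx w = rsubmx (u - w) by rewrite raddfB.
have E1 : `|G (lsubmx z) - G (lsubmx y) - (lsubmx z - lsubmx y) *m J (lsubmx z0)| <= e / 2 * `|z - y|.
  have := H1 (lsubmx y) (lsubmx z); rewrite !sl => E1.
  have {}E1 := E1 (le_lt_trans (lsubmx_norm_le _) y1) (le_lt_trans (lsubmx_norm_le _) z1).
  by rewrite (le_trans E1)// ler_wpM2l ?lsubmx_norm_le// divr_ge0// ltW.
have bl (u w : 'rV[R]_(n + (N + m))) : `|lsubmx (rsubmx u) - lsubmx (rsubmx w)| <= `|u - w|.
  by rewrite sl' sr (le_trans (lsubmx_norm_le _))// rsubmx_norm_le.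
have br (u w : 'rV[R]_(n + (N + m))) : `|rsubmx (rsubmx u) - rsubmx (rsubmx w)| <= `|u - w|.
  by rewrite sr' sr (le_trans (rsubmx_norm_le _))// rsubmx_norm_le.
have bil (u w : 'rV[R]_(n + (N + m))) (u' w' : 'rV[R]_(n + (N + m))) (q : R) : `|u' - w'| <= q ->
    `|(lsubmx (rsubmx u) - lsubmx (rsubmx w)) *m tau *m
      (rsubmx (rsubmx u') - rsubmx (rsubmx w'))| <= K * `|u - w| * q.
  move=> uq; rewrite (le_trans (mulmx11_norm _ _))//; apply: ler_pM => //.
    by rewrite (le_trans (tK _))// ler_pM2l.
  exact: le_trans (br _ _) uq.
have E2 := bil z y z z0 _ (ltW z2).
have E3 := bil y z0 z y _ (lexx _).
have {}E3 := le_trans E3 (ler_wpM2r (normr_ge0 _) (ler_wpM2l (ltW K0) (ltW y2))).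
have EE : K * `|z - y| * (e / (4 * K)) = e / 4 * `|z - y| by field; rewrite gt_eqF.
have EE' : K * (e / (4 * K)) * `|z - y| = e / 4 * `|z - y| by field; rewrite gt_eqF.
rewrite EE in E2; rewrite EE' in E3.
have -> : lift_map z - lift_map y - (z - y) *m lift_jac z0 =
  (G (lsubmx z) - G (lsubmx y) - (lsubmx z - lsubmx y) *m J (lsubmx z0)) +
  ((lsubmx (rsubmx z) - lsubmx (rsubmx y)) *m tau *m (rsubmx (rsubmx z) - rsubmx (rsubmx z0)) +
   (lsubmx (rsubmx y) - lsubmx (rsubmx z0)) *m tau *m (rsubmx (rsubmx z) - rsubmx (rsubmx y))).
  rewrite /lift_jac -[(z - y) *m _]/(_ *m _) -{1}[z - y]hsubmxK mul_row_col.
  rewrite -{1}[rsubmx (z - y)]hsubmxK mul_row_col -!(sl, sr, sl', sr').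
  rewrite /lift_map; move: (lsubmx z) (lsubmx y) (lsubmx z0) (rsubmx z) (rsubmx y) (rsubmx z0).
  move=> a b c a' b' c'.
  move: (lsubmx a') (lsubmx b') (lsubmx c') (rsubmx a') (rsubmx b') (rsubmx c').
  move=> l1 l2 l3 r1 r2 r3.
  rewrite [(r1 - r2) *m (_ - _)]mulmxBr mulmx1 mul_mx_scalar.
  rewrite [(l1 - l2) *m (_ - _)]mulmxBr mulmxA !(mulmxBl, mulmxBr).
  have sc (l : 'rV[R]_N) (r : 'rV[R]_m) : l *m tau *m r = (l *m tau) ord0 ord0 *: r.
    by rewrite [in LHS](mx11_scalar (l *m tau)) mul_scalar_mx.
  rewrite !sc; move: ((l1 *m tau) _ _) ((l2 *m tau) _ _) ((l3 *m tau) _ _) => x1 x2 x3.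
  move: (G a) (G b) (a *m _) (b *m _) (l1 *m Dm) (l2 *m Dm) => X1 X2 X3 X4 X5 X6.
  by apply/rowP => i; rewrite !mxE; ring.
rewrite (le_trans (ler_normD _ _))//.
have := ler_normD ((lsubmx (rsubmx z) - lsubmx (rsubmx y)) *m tau *m (rsubmx (rsubmx z) - rsubmx (rsubmx z0)))
   ((lsubmx (rsubmx y) - lsubmx (rsubmx z0)) *m tau *m (rsubmx (rsubmx z) - rsubmx (rsubmx y))).
lra.
Qed.

End LiftedConstraint.

(** * Curves close to chords in the preimage of a convex set *)

Section ConvexChord.
Variable R : realType.

Lemma mulmx_norm_rows N m (E : 'M[R]_(N, m)) (e : R) : (forall j, `|row j E| <= e) ->
  forall l : 'rV[R]_N, `|l *m E| <= N%:R * e * `|l|.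
Proof.
move=> Ee l; rewrite mulmx_sum_row (le_trans (ler_norm_sum _ _ _))//.
apply: (@le_trans _ _ (\sum_(j < N) `|l| * e)).
  by apply: ler_sum => j _; rewrite normrZ; apply: ler_pM; rewrite ?le_rv_norm.
by rewrite sumr_const card_ord -[leLHS]mulr_natl; rewrite -mulrA [e * _]mulrC.
Qed.

(** The rows of the matrix multiplied by [l] are the cone elements [u_j A - tau_j (d_j - g)]. An
    error [(4 * N.+1)^-1] per row leaves 1/4 in total, which the Newton steps tolerate. *)
Lemma approx_positive_basis n m (A : 'M[R]_(n, m)) (D : set 'rV[R]_m) (g : 'rV[R]_m) :
  (forall (w : 'rV[R]_m) (e : R), 0 < e -> exists (v : 'rV[R]_n) (d : 'rV[R]_m) (tau : R),
    [/\ D d, 0 <= tau & `|v *m A - tau *: (d - g) - w| <= e]) ->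
  forall N (T : 'M[R]_(N, m)), exists (U : 'M[R]_(N, n)) (d : 'I_N -> 'rV[R]_m)
    (tau : 'cV[R]_N), [/\ forall j, D (d j), forall j, 0 <= tau j ord0 &
    forall l : 'rV[R]_N, `|l *m (U *m A + (tau *m g -
      \matrix_j (tau j ord0 *: d j))) - l *m T| <= 4^-1 * `|l|].
Proof.
move=> dense N T; pose e : R := (4 * N.+1%:R)^-1.
have e0 : 0 < e by rewrite invr_gt0 mulr_gt0.
have /choice[q Hq] : forall j : 'I_N, exists q : 'rV[R]_n * 'rV[R]_m * R,
    [/\ D q.1.2, 0 <= q.2 & `|q.1.1 *m A - q.2 *: (q.1.2 - g) - row j T| <= e].
  by move=> j; have [v [d [tau H]]] := dense (row j T) _ e0; exists (v, d, tau).
exists (\matrix_j (q j).1.1), (fun j => (q j).1.2), (\col_j (q j).2).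
split=> [j|j|l]; rewrite ?mxE; [by have [] := Hq j|by have [] := Hq j|].
rewrite -mulmxBr.
apply: (@le_trans _ _ (N%:R * e * `|l|)).
  apply: mulmx_norm_rows => j; have [_ _] := Hq j.
  suff -> : row j (\matrix_j (q j).1.1 *m A + (\col_j (q j).2 *m g -
      \matrix_j0 ((\col_j (q j).2) j0 ord0 *: (q j0).1.2)) - T) =
    (q j).1.1 *m A - (q j).2 *: ((q j).1.2 - g) - row j T by [].
  rewrite !linearB/= !linearD/= linearN/= !row_mul !rowK.
  rewrite (mx11_scalar (row j _)) mul_scalar_mx !mxE.
  by move: (_ *m A) => X; apply/rowP => i; rewrite !mxE; ring.
rewrite ler_wpM2r// /e invfM mulrCA ler_piMr ?invr_ge0//.
by rewrite ler_pdivrMr// mul1r ler_nat.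
Qed.

(** The curve is the [x]-component of a bumped chord in the lifted space; both endpoints are lifted
    with [l = 0] and [y = G x], hence to zeros of [f]. *)
Lemma convex_chord_curve n m (G : 'rV[R]_n -> 'rV[R]_m) (J : 'rV[R]_n -> 'M[R]_(n, m))
    (xb : 'rV[R]_n) (dU : R) (D : set 'rV[R]_m) : 0 < dU ->
  (forall x, `|x - xb| < dU -> sdiff G (J x) x) -> convex_set_in D -> D (G xb) ->
  (forall (w : 'rV[R]_m) (e : R), 0 < e -> exists (v : 'rV[R]_n) (d : 'rV[R]_m) (tau : R),
    [/\ D d, 0 <= tau & `|v *m J xb - tau *: (d - G xb) - w| <= e]) ->
  forall eps : R, 0 < eps -> exists2 rho : R, 0 < rho & forall x x',
    `|x - xb| < rho -> `|x' - xb| < rho -> D (G x) -> D (G x') ->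
    exists gam gam' : R -> 'rV[R]_n, [/\ forall t, `|t| < 2 -> sdiff1 gam (gam' t) t,
      gam 0 = x, gam 1 = x' & forall t, Rint01 t -> [/\ D (G (gam t)),
        `|gam t - xb| < dU & `|gam' t - (x' - x)| <= eps * `|x' - x| ]].
Proof.
move=> dU0 GJ cD Db dense eps eps0.
(* A positive basis: the unit vectors and the opposite of their sum. [B] below is a left inverse of
   [T], and [lb] the linear relation with all coefficients 1. *)
pose T : 'M[R]_(m + 1, m) := col_mx 1%:M (const_mx (-1)).
have [U [d [tau [Dd tau0 UE]]]] := approx_positive_basis dense T.
set Dm := \matrix_j _ in UE.
pose B : 'M[R]_(m, m + 1) := row_mx 1%:M 0.
pose lb : 'rV[R]_(m + 1) := const_mx 1.
have BT : B *m T = 1%:M by rewrite mul_row_col mul1mx mul0mx addr0.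
have lbT : lb *m T = 0.
  rewrite /lb -row_mx_const mul_row_col mulmx1; apply/rowP => i.
  by rewrite !mxE big_ord1 !mxE mul1r addrN.
have sB (s : 'rV[R]_m) : `|s *m B| <= `|s|.
  by rewrite mul_mx_row mulmx1 mulmx0; apply: row_mx_norm_le; rewrite ?normr0.
have lb1 : `|lb| <= 1 by apply: rv_norm_le => // i; rewrite mxE normr1.
have lbE j : lb ord0 j = 1 by rewrite mxE.
clearbody B lb.
(* [P] and [v] change [l] through [B] and [lb], move [x] accordingly by [U], and leave [y] on the
   segment from [G x] to [G x']. *)
pose P : 'M[R]_(m, n + ((m + 1) + m)) := row_mx (B *m U) (row_mx B 0).
pose v : 'rV[R]_(n + ((m + 1) + m)) := row_mx (lb *m U) (row_mx lb 0).
pose ext (x : 'rV[R]_n) y : 'rV[R]_(n + ((m + 1) + m)) := row_mx x (row_mx 0 y).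
pose p := ext xb (G xb).
have jacE (l : 'rV[R]_(m + 1)) :
    row_mx (l *m U) (row_mx l 0) *m lift_jac J Dm tau p =
    l *m (U *m J xb + (tau *m G xb - Dm)).
  rewrite /lift_jac /p /ext !row_mxKl !row_mxKr row_mxKl !mul_row_col mul0mx addr0.
  by rewrite [RHS]mulmxDr mulmxA.
pose f := lift_map G Dm tau.
have fext x : f (ext x (G x)) = 0.
  by rewrite /f /lift_map /ext !row_mxKl !row_mxKr row_mxKl !mul0mx addr0 subrr subr0.
have [|||C C0 Hcurve] := @bumped_chord_curve R _ _ f (lift_jac J Dm tau) p dU P v dU0 _ (fext xb).
- move=> z zp; apply: lift_sdiff; apply: GJ; apply: le_lt_trans zp.
  have -> : lsubmx z - xb = lsubmx (z - p) by rewrite raddfB/= /p /ext row_mxKl.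
  exact: lsubmx_norm_le.
- move=> s; have -> : s *m P = row_mx (s *m B *m U) (row_mx (s *m B) 0).
    by rewrite /P [LHS]mul_mx_row [s *m row_mx B 0]mul_mx_row mulmx0 mulmxA.
  rewrite jacE -[X in `|_ - X|](mulmx1 s) -BT mulmxA.
  by rewrite (le_trans (UE _))// ler_wpM2l ?invr_ge0.
- by rewrite jacE -[X in `|X|](subr0) -lbT (le_trans (UE _))// ler_piMr ?invr_ge0.
have [|d3 d30 [L L0 GL]] := sdiff_lipschitz (GJ xb _); first by rewrite subrr normr0.
have [Kt Kt0 tK] := mulmx_bounded tau.
(* The factor [1 + L] compares lifted chords with chords. *)
pose e1 := eps / (C * (1 + L)).
have L1 : 0 < 1 + L by rewrite addr_gt0.
have e10 : 0 < e1 by rewrite divr_gt0// mulr_gt0.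
have e1E : C * e1 * (1 + L) = eps by rewrite /e1; field; rewrite !gt_eqF.
clearbody e1.
have [rho2 rho20 {}Hcurve] := Hcurve e1 dU e10 dU0.
(* The last bound ensures that the weights sum to at most 1, from [|gl| <= 2 * k] and
   [k <= e1 * ((1 + L) * (2 * rho))]. *)
pose rho := Num.min (Num.min d3 (rho2 / (1 + L))) (Kt * (4 * e1 * (1 + L)))^-1.
have q0 : 0 < Kt * (4 * e1 * (1 + L)) by rewrite !mulr_gt0.
have rho0 : 0 < rho by rewrite !lt_min d30 divr_gt0//= invr_gt0.
have [m1 m2 m3] : [/\ rho <= d3, (1 + L) * rho <= rho2 & Kt * (4 * e1 * (1 + L)) * rho <= 1].
  split; first by rewrite !ge_min lexx.
  - by rewrite mulrC -ler_pdivlMr// !ge_min lexx orbT.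
  - by rewrite mulrC -ler_pdivlMr// div1r !ge_min lexx orbT.
clearbody rho; exists rho => // x x' hx hx' Dx Dx'.
have extB y y' : ext y' (G y') - ext y (G y) = ext (y' - y) (G y' - G y).
  by rewrite /ext opp_row_mx add_row_mx opp_row_mx add_row_mx subr0.
have ext_le y y' : `|y - xb| < d3 -> `|y' - xb| < d3 ->
    `|ext y' (G y') - ext y (G y)| <= (1 + L) * `|y' - y|.
  move=> hy hy'; rewrite extB; apply: row_mx_norm_le.
    by rewrite mulrDl mul1r lerDl mulr_ge0// ltW.
  apply: row_mx_norm_le; first by rewrite normr0 mulr_ge0// ltW.
  by rewrite (le_trans (GL _ _ hy hy'))// mulrDl mul1r lerDr.
have xbd : `|xb - xb| < d3 by rewrite subrr normr0.
have near y : `|y - xb| < rho -> `|ext y (G y) - p| < rho2.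
  move=> hy; have hy3 := lt_le_trans hy m1.
  apply: (le_lt_trans (ext_le _ _ xbd hy3)).
  by apply: lt_le_trans m2; rewrite ltr_pM2l.
have [s [s' [Dgam s0 s1 Hgam]]] := Hcurve _ _ (near _ hx) (near _ hx') (fext x) (fext x').
set z := ext x (G x) in Dgam Hgam; set z' := ext x' (G x') in Dgam Hgam.
set k := e1 * `|z' - z| in Dgam Hgam.
pose gam t := z + t *: (z' - z) + (k * (t * (1 - t))) *: v + s t *m P.
pose gam' t := z' - z + (k * (1 - 2 * t)) *: v + s' t *m P.
have {}Hgam t : Rint01 t -> [/\ f (gam t) = 0, `|gam t - p| < dU,
  `|s t| <= k * (t * (1 - t)) & `|gam' t - (z' - z)| <= C * e1 * `|z' - z| ] := Hgam t.
pose Pi : 'M[R]_(n + ((m + 1) + m), n) := col_mx 1%:M 0.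
have PiE w : w *m Pi = lsubmx w.
  by rewrite -[w in LHS]hsubmxK mul_row_col mulmx1 mulmx0 addr0.
have H : `|z' - z| <= (1 + L) * `|x' - x|.
  by apply: ext_le; exact: lt_le_trans m1.
exists (fun t => gam t *m Pi), (fun t => gam' t *m Pi); split.
- by move=> t t2; apply: sdiff1_mulmx; exact: Dgam.
- by rewrite /gam s0 mul0mx mul0r mulr0 !scale0r !addr0 PiE /z /ext row_mxKl.
- rewrite /gam s1 mul0mx subrr !mulr0 scale0r !addr0 scale1r addrC subrK.
  by rewrite PiE /z' /ext row_mxKl.
move=> t It; have [t0 t1] := andP It.
have [fg gp sk g'] := Hgam t It.
split; last 2 first.
- rewrite PiE; have -> : lsubmx (gam t) - xb = lsubmx (gam t - p).
    by rewrite raddfB/= /p /ext row_mxKl.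
  exact: le_lt_trans (lsubmx_norm_le _) gp.
- have -> : gam' t *m Pi - (x' - x) = lsubmx (gam' t - (z' - z)).
    have zzE : lsubmx (z' - z) = x' - x by rewrite /z /z' extB /ext row_mxKl.
    by rewrite -zzE -!PiE -mulmxBl.
  rewrite (le_trans (lsubmx_norm_le _))// (le_trans g')//.
  apply: (@le_trans _ _ (C * e1 * ((1 + L) * `|x' - x|))).
    by rewrite ler_pM2l// mulr_gt0.
  by rewrite mulrA e1E.
set c := k * (t * (1 - t)) in sk.
have c0 : 0 <= c by rewrite (le_trans _ sk).
pose gl := c *: lb + s t *m B.
pose gy := (1 - t) *: G x + t *: G x'.
have Dy : D gy by apply: cD.
have gamE : gam t = row_mx (lsubmx (gam t)) (row_mx gl gy).
  rewrite -[LHS]hsubmxK; congr row_mx.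
  rewrite /gam -/c /z /z' extB /z /ext /v /P.
  rewrite !(scale_row_mx, add_row_mx, mul_mx_row) row_mxKr.
  rewrite mulmx0 !scaler0 !addr0 add0r; congr row_mx.
  by apply/rowP => i; rewrite !mxE; ring.
(* The bump raises every coordinate by [c], and the correction lowers none by more than [c]. *)
have gl0 j : 0 <= gl ord0 j.
  rewrite 2!mxE lbE mulr1 -lerBlDl sub0r -[X in _ <= X]opprK lerN2.
  have : `|(s t *m B) ord0 j| <= c by rewrite (le_trans (le_rv_norm _ _))// (le_trans (sB _)).
  by rewrite mxE ler_norml => /andP[]; rewrite lerNl.
have gtau : (gl *m tau) ord0 ord0 <= 1.
  rewrite (le_trans (ler_norm _))// (le_trans (le_rv_norm _ _))// (le_trans (tK _))//.
  apply: le_trans m3; rewrite -!mulrA ler_pM2l//.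
  have cB : `|gl| <= 2 * c.
    rewrite (le_trans (ler_normD _ _))// normrZ ger0_norm//.
    have := sB (s t); have : c * `|lb| <= c * 1 by rewrite ler_wpM2l.
    clear -sk; lra.
  have ck : c <= k.
    rewrite /c ler_piMr//; first by rewrite mulr_ge0// ltW.
    by apply: mulr_ile1 => //; rewrite ?subr_ge0// lerBlDr lerDl.
  have xx : `|x' - x| <= 2 * rho.
    by have := ler_distD xb x' x; rewrite [`|xb - x|]distrC; clear -hx hx'; lra.
  have : k <= e1 * ((1 + L) * (2 * rho)).
    by rewrite /k ler_pM2l// (le_trans H)// ler_pM2l.
  clear -cB ck; lra.
(* This is [f (gam t) = 0] solved for [G], the rows of [Dm] being [tau j ord0 *: d j]. *)
have -> : G (gam t *m Pi) = gy + \sum_j (gl ord0 j * tau j ord0) *: (d j - gy).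
  rewrite PiE; move: fg; rewrite /f /lift_map gamE !row_mxKl !row_mxKr row_mxKl.
  have -> : gl *m Dm = \sum_j (gl ord0 j * tau j ord0) *: d j.
    by rewrite mulmx_sum_row; apply: eq_bigr => j _; rewrite rowK scalerA.
  rewrite (mx11_scalar (gl *m tau)) mul_scalar_mx.
  have -> : (gl *m tau) 0 0 = \sum_j gl ord0 j * tau j ord0 by rewrite mxE.
  have -> : \sum_j (gl ord0 j * tau j ord0) *: (d j - gy) =
      \sum_j (gl ord0 j * tau j ord0) *: d j - (\sum_j gl ord0 j * tau j ord0) *: gy.
    by rewrite scaler_suml -sumrB; apply: eq_bigr => j _; rewrite scalerBr.
  set Y := \sum_j (gl ord0 j * tau j ord0) *: d j.
  set Z := \sum_j gl ord0 j * tau j ord0.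
  move: (G (lsubmx _)) => X /eqP.
  rewrite -addrA addr_eq0 => /eqP XE; rewrite -[X](subrK gy) XE.
  by apply/rowP => i; rewrite !mxE; ring.
apply: convex_comb => //; first by move=> j; rewrite mulr_ge0.
by move: gtau; rewrite mxE.
Qed.

End ConvexChord.

(** * From the constraint qualification to curves in C *)

Section Amenable.
Variable R : realType.

Lemma sdiff_row_mx n k m (f : 'rV[R]_n -> 'rV[R]_k) (g : 'rV[R]_n -> 'rV[R]_m) A B p :
  sdiff f A p -> sdiff g B p -> sdiff (fun x => row_mx (f x) (g x)) (row_mx A B) p.
Proof.
move=> fA gB e e0; have [d1 d10 H1] := fA _ e0; have [d2 d20 H2] := gB _ e0.
exists (Num.min d1 d2) => [|y z]; first by rewrite lt_min d10.
rewrite !lt_min => /andP[y1 y2] /andP[z1 z2].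
rewrite mul_mx_row !opp_row_mx !add_row_mx.
by apply: row_mx_norm_le; [exact: H1|exact: H2].
Qed.

(** The difference quotients of a curve in [M] tend to [v], and strict differentiability makes [A]
    nearly kill them, as [Phi] vanishes at both points of the quotient. *)
Lemma tangent_space_ker n k (M : set 'rV[R]_n) (Phi : 'rV[R]_n -> 'rV[R]_k) A p v :
  sdiff Phi A p -> (\forall x \near p, M x -> Phi x = 0) -> M p ->
  tangent_space M p v -> v *m A = 0.
Proof.
move=> PhiA PhiM Mp [gam [ O [oO [ O0 [[cg dg] [g0 [gM gv]]]]]]].
have [K K0 AK] := mulmx_bounded A.
have q_cvg : (fun h : R => h^-1 *: ((gam \o shift 0) (h *: 1) - gam 0)) @ 0^' --> v.
  have [/(_ 0 O0) /cvg_ex[l Hl] _] := dg 1.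
  by rewrite -gv /derive; move/cvg_lim: (Hl) => ->.
apply/normr0_eq0/le_anti; rewrite normr_ge0 andbT; apply/ler_addgt0Pr => e e0.
rewrite add0r; pose c := `|v| + 1 + K.
have c0 : 0 < c by rewrite addr_gt0// ltr_wpDl.
(* Chosen for [e1 * (|v| + 1) + K * e1 <= e]. *)
pose e1 := Num.min 1 (e / c).
have e10 : 0 < e1 by rewrite lt_min ltr01 divr_gt0.
have [d d0 Hd] := PhiA _ e10.
have cg0 := cg _ O0; rewrite /prop_for /continuous_at g0 in cg0.
have [h [h0 hq hd hM]] : exists h : R, [/\ h != 0, `|v - h^-1 *: (gam h - p)| <= e1,
    `|gam h - p| < d & Phi (gam h) = 0].
  have /filter_ex : \forall h \near (0 : R)^', [/\ h != 0,
      `|v - h^-1 *: (gam h - p)| <= e1, `|gam h - p| < d & Phi (gam h) = 0].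
    near=> h; split.
    - by near: h; exact: nbhs_dnbhs_neq.
    - have : `|v - h^-1 *: ((gam \o shift 0) (h *: 1) - gam 0)| <= e1.
        by near: h; move/cvgrPdist_le: q_cvg; apply.
      by rewrite /= addr0 g0 /GRing.scale/= mulr1.
    - rewrite distrC; near: h; apply: nbhs_dnbhs.
      by move/cvgrPdist_lt: cg0; apply.
    - have : M (gam h) by near: h; apply: nbhs_dnbhs.
      by near: h; apply: nbhs_dnbhs; exact: (cg0 _ PhiM).
  by [].
have pd : `|p - p| < d by rewrite subrr normr0.
have Phip : Phi p = 0 by have := nbhs_singleton PhiM; apply.
have := Hd _ _ pd hd; rewrite hM Phip subrr sub0r normrN => E.
set q := h^-1 *: (gam h - p) in hq.
have {}E : `|q *m A| <= e1 * `|q|.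
  rewrite /q -scalemxAl !normrZ mulrCA ler_wpM2l//.
have vq : `|q| <= `|v| + 1.
  have := ler_normB v (v - q); rewrite opprB addrC subrK.
  have : e1 <= 1 by rewrite ge_min lexx.
  clear -hq; lra.
have := ler_normD (q *m A) ((v - q) *m A); rewrite -mulmxDl addrC subrK => /le_trans; apply.
have e1c : e1 * c <= e.
  by rewrite -ler_pdivlMr// ge_min lexx orbT.
have E1 : e1 * `|q| <= e1 * (`|v| + 1) by rewrite ler_pM2l.
have E2 : `|(v - q) *m A| <= K * e1 by rewrite (le_trans (AK _))// ler_pM2l.
move: e1c; rewrite /c; clear -E E1 E2; lra.
Unshelve. all: by end_near. Qed.

Lemma amenable_chord_curve n (M C : set 'rV[R]_n) xb :
  embedded_submanifold3 M -> C `<=` M -> C xb -> amenable_in M C xb ->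
  forall eps : R, 0 < eps -> exists2 rho : R, 0 < rho & forall x x', C x -> C x' ->
    `|x - xb| < rho -> `|x' - xb| < rho ->
    exists2 gam, C1_curve_in C x x' gam &
      forall t, Rint01 t -> `|'D_1 gam t - (x' - x)| <= eps * `|x' - x|.
Proof.
move=> subM CM Cxb [m [ O [F [D [oO [ Oxb [FC [_ [cD [CF CQ]]]]]]]]]] eps eps0.
have Mxb := CM _ Cxb.
have [k [U [Phi [oU Up PhiC surj PhiM]]]] := subM _ Mxb.
have PhiC1 : Ck 1 U Phi := Ck_le1 PhiC.
have PhiJ x : U x -> sdiff Phi (jac Phi x) x by move=> Ux; exact: Ck1_sdiff oU PhiC1 Ux.
have FJ x : O x -> sdiff F (jac F x) x by move=> Ox; exact: Ck1_sdiff oO FC Ox.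
have Phib : Phi xb = 0 by apply/(PhiM _ Up).
have Db : D (F xb) by apply/(CF _ Mxb Oxb).
have /nbhs_normP[dU /= dU0 HU] : nbhs xb (U `&` O).
  by apply: filterI; exact: open_nbhs_nbhs.
have ballUO z : `|z - xb| < dU -> U z /\ O z by move=> h; apply: HU; rewrite /= distrC.
pose G x := row_mx (Phi x) (F x).
pose J x := row_mx (jac Phi x) (jac F x).
pose D' := [set w : 'rV[R]_(k + m) | lsubmx w = 0 /\ D (rsubmx w)].
(* The slice of the cone where the [Phi]-component is zero, seen in the target of [F] alone. *)
pose S := [set s : 'rV[R]_m | exists (v : 'rV[R]_n) (d : 'rV[R]_m) (tau : R),
  [/\ v *m jac Phi xb = 0, D d, 0 <= tau & s = v *m jac F xb - tau *: (d - F xb)]].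
have dense : forall w (e : R), 0 < e -> exists2 s, S s & `|w - s| < e.
  apply: cone_dense.
  - exists 0, (F xb), 0; split=> //; first by rewrite mul0mx.
    by rewrite mul0mx scale0r subr0.
  - move=> _ _ [v [d [tau [v0 Dd tau0 ->]]]] [v' [d' [tau' [v'0 Dd' tau'0 ->]]]].
    (* Two directions [d - F xb] and [d' - F xb] merge by convexity, with weights proportional to
       [tau] and [tau'], unless both are 0. *)
    have [tt0|tt0] := eqVneq (tau + tau') 0.
      have t0 : tau = 0 by apply/le_anti; rewrite tau0 andbT; clear -tt0 tau'0; lra.
      have t'0 : tau' = 0 by apply/le_anti; rewrite tau'0 andbT; clear -tt0 tau0; lra.
      exists (v + v'), d, 0; split=> //; first by rewrite mulmxDl v0 v'0 addr0.
      by rewrite t0 t'0 !scale0r !subr0 mulmxDl.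
    have ttp : 0 < tau + tau' by rewrite lt_def tt0 addr_ge0.
    exists (v + v'), ((1 - tau' / (tau + tau')) *: d + (tau' / (tau + tau')) *: d'), (tau + tau').
    split; [by rewrite mulmxDl v0 v'0 addr0| |exact: ltW|].
      apply: cD => //; rewrite divr_ge0//=; last exact: ltW.
      by rewrite ler_pdivrMr// mul1r lerDr.
    rewrite mulmxDl; move: (v *m _) (v' *m _) => X Y.
    by apply/rowP => i; rewrite !mxE; field.
  - move=> a _ a0 [v [d [tau [v0 Dd tau0 ->]]]]; exists (a *: v), d, (a * tau).
    split=> //; [by rewrite -scalemxAl v0 scaler0|exact: mulr_ge0|].
    by rewrite -scalemxAl scalerBr scalerA.
  (* Taking [v = 0] puts [y] in the normal cone; taking [tau = 0] with [v] and [- v] makes it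
     orthogonal to the tangential derivatives of [F]. *)
  - move=> y Hy; apply: CQ.
      move=> d Dd; have : S (- (d - F xb)).
        by exists 0, d, 1; split=> //; rewrite ?mul0mx// scale1r sub0r.
      by move=> /Hy; rewrite dotvNr oppr_ge0.
    move=> v Tv; have v0 : v *m jac Phi xb = 0.
      apply: (tangent_space_ker (PhiJ _ Up) _ Mxb Tv).
      have Unb : nbhs xb U by exact: open_nbhs_nbhs.
      by near=> x => Mx; apply/(PhiM x) => //; near: x.
    have [_ ->] := sdiff_is_derive v (FJ _ Oxb).
    have S1 : S (v *m jac F xb).
      by exists v, (F xb), 0; split=> //; rewrite scale0r subr0.
    have S2 : S (- (v *m jac F xb)).
      exists (- v), (F xb), 0; split=> //; first by rewrite mulNmx v0 oppr0.
      by rewrite scale0r subr0 mulNmx.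
    by apply/le_anti; rewrite (Hy _ S1) andbT -oppr_ge0 -dotvNr; exact: Hy.
(* [v0] attains the [Phi]-component exactly, since [Phi] is a submersion at [xb]; the rest is
   approximated by [dense] without disturbing it. *)
have denseG : forall (w : 'rV[R]_(k + m)) (e : R), 0 < e ->
    exists (v : 'rV[R]_n) (d : 'rV[R]_(k + m)) (tau : R),
    [/\ D' d, 0 <= tau & `|v *m J xb - tau *: (d - G xb) - w| <= e].
  move=> w e e0; have [v0 v0E] := surj (lsubmx w).
  have [_ v0E'] := sdiff_is_derive v0 (PhiJ _ Up); rewrite v0E' in v0E.
  have [_ [v [d [tau [vP Dd tau0 ->]]]] H] := dense (rsubmx w - v0 *m jac F xb) _ e0.
  exists (v0 + v), (row_mx 0 d), tau; split=> //.
    by rewrite /D'/= row_mxKl row_mxKr.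
  rewrite /J /G Phib mul_mx_row -[w]hsubmxK !(opp_row_mx, add_row_mx, scale_row_mx).
  apply: row_mx_norm_le.
    by rewrite mulmxDl vP addr0 v0E subrr scaler0 subr0 subrr normr0 ltW.
  move/ltW: H; rewrite -normrN; apply: le_trans; rewrite le_eqVlt; apply/orP; left; apply/eqP.
  congr (`|_|); rewrite mulmxDl; move: (v0 *m _) (v *m _) (rsubmx w) => X Y Z.
  by apply/rowP => i; rewrite !mxE; ring.
have [|||rho rho0 H] := @convex_chord_curve R n (k + m) G J xb dU D' dU0 _ _ _ denseG eps eps0.
- by move=> x /ballUO[Ux Ox]; apply: sdiff_row_mx; [exact: PhiJ|exact: FJ].
- move=> a b t [a0 Da] [b0 Db'] t01; split.
    by rewrite linearD/= !linearZ/= a0 b0 !scaler0 addr0.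
  by rewrite linearD/= !linearZ/=; exact: cD.
- by rewrite /D' /G/= row_mxKl row_mxKr.
exists (Num.min rho dU) => [|x x' Cx Cx']; first by rewrite lt_min rho0.
rewrite !lt_min => /andP[hx xU] /andP[hx' x'U].
have D'C z : C z -> `|z - xb| < dU -> D' (G z).
  move=> Cz /ballUO[Uz Oz]; have Mz := CM _ Cz.
  by rewrite /D' /G/= row_mxKl row_mxKr; split; [apply/(PhiM _ Uz)|apply/(CF _ Mz Oz)].
have CD' z : D' (G z) -> `|z - xb| < dU -> C z.
  rewrite /D' /G/= row_mxKl row_mxKr => -[Pz Dz] /ballUO[Uz Oz].
  have Mz : M z by apply/(PhiM _ Uz).
  by apply/(CF _ Mz Oz).
have [gam [gam' [gE g0 g1 gH]]] := H _ _ hx hx' (D'C _ Cx xU) (D'C _ Cx' x'U).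
have [gC gD] := sdiff1_Ck1 (@open_norm_lt2 R) gE.
exists gam.
  exists [set t | `|t| < 2]; split; first exact: open_norm_lt2.
  split; first exact: Rint01_norm2.
  split=> //; split=> // t It; have [Dg gU _] := gH t It; exact: CD'.
move=> t It; have [_ _] := gH t It; rewrite gD//; exact: Rint01_norm2.
Unshelve. all: by end_near. Qed.

End Amenable.

(** * Both velocities compared with the chord *)

Theorem theorem4p7 (R : realType) (n : nat) (M C : set 'rV[R]_n) (xb : 'rV[R]_n) :
  embedded_submanifold3 M -> C `<=` M -> C xb ->
  amenable_in M C xb -> smoothly_approx_convex M C xb.
Proof.
move=> subM CM Cxb amen eps eps0; have Mxb := CM _ Cxb.
have n0 : 0 < n.+1%:R :> R by [].
(* Half of [eps] goes to [gam] and half to [g], as [4 * beta = eps / 2]; [n.+1] pays for passing to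
   the Euclidean norm. *)
pose eps1 := eps / (2 * n.+1%:R).
have eps10 : 0 < eps1 by rewrite divr_gt0// mulr_gt0.
have [rho1 rho10 Hgam] := amenable_chord_curve subM CM Cxb amen eps10.
have [rho2 rho20 [K K0 HdM]] := dM_le_chord subM Mxb.
pose beta := eps / 8; have beta0 : 0 < beta by rewrite divr_gt0.
(* [Q * rho] will bound [dM M x x'], through [(1 + K) * enorm (x' - x)]. *)
pose Q := 2 * n.+1%:R * (1 + K).
have K1 : 0 < 1 + K by rewrite addr_gt0.
have Q0 : 0 < Q by rewrite !mulr_gt0.
(* The bound 1 makes the square of the chord length at most that length, [rho2 / 2] keeps [g] where
   [HdM] applies, and the last bound yields [betaK]. *)
pose Lmax := Num.min (Num.min 1 (rho2 / 2)) (beta ^+ 2 / (2 * K)).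
have Lmax0 : 0 < Lmax by rewrite !lt_min ltr01 !divr_gt0// ?exprn_gt0// mulr_gt0.
have [Lmax1 Lmax2 Lmax3] : [/\ Lmax <= 1, Lmax <= rho2 / 2 & 2 * K * Lmax <= beta ^+ 2].
  split; rewrite ?ge_min ?lexx ?orbT//.
  by rewrite mulrC -ler_pdivlMr ?mulr_gt0// !ge_min lexx ?orbT.
clearbody Lmax.
pose rho := Num.min (Num.min rho1 (rho2 / 2)) (Lmax / Q).
have rho0 : 0 < rho by rewrite !lt_min rho10 !divr_gt0.
have [r1 r2 r3] : [/\ rho <= rho1, rho <= rho2 / 2 & Q * rho <= Lmax].
  split; rewrite ?ge_min ?lexx ?orbT//.
  by rewrite mulrC -ler_pdivlMr// !ge_min lexx ?orbT.
clearbody rho.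
exists (ball xb rho); split; first exact: nbhsx_ballx.
rewrite -ball_normE => x x' Cx Cx'; rewrite /= ![`|xb - _|]distrC => hx hx' xx'.
have [gam gamC gamD] := Hgam _ _ Cx Cx' (lt_le_trans hx r1) (lt_le_trans hx' r1).
exists gam; split=> // g [gM g0 g1 gd] t It w gw.
have hx2 : `|x - xb| < rho2 by clear -hx r2 rho20; lra.
have hx2' : `|x' - xb| < rho2 by clear -hx' r2 rho20; lra.
have up := HdM _ _ (CM _ Cx) (CM _ Cx') hx2 hx2'.
have lo := chord_le_dM M x x'.
have [L LE] : exists L : R, dM M x x' = L%:E.
  exists (fine (dM M x x')); rewrite fineK// fin_numElt.
  by rewrite (lt_le_trans (ltNyr _) lo) (le_lt_trans up (ltry _)).
rewrite LE !lee_fin in up lo gd *.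
have L0 : 0 <= L := le_trans (enorm_ge0 _) lo.
have LLmax : L <= Lmax.
  have h1 : enorm (x' - x) <= 2 * n.+1%:R * rho.
    rewrite (le_trans (enorm_le_norm _))// [2 * _]mulrC -mulrA.
    apply: ler_pM => //; first by rewrite ler_nat.
    by have := ler_distD xb x' x; rewrite [`|xb - x|]distrC; clear -hx hx'; lra.
  have h2 : 2 * n.+1%:R * rho <= 1.
    apply: le_trans Lmax1; apply: le_trans r3.
    by rewrite ler_pM2r// /Q ler_peMr// ?mulr_ge0// lerDl ltW.
  have h3 : enorm (x' - x) ^+ 2 <= enorm (x' - x).
    by rewrite expr2 ler_piMr ?enorm_ge0// (le_trans h1).
  have h4 : K * enorm (x' - x) ^+ 2 <= K * enorm (x' - x) by rewrite ler_pM2l.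
  have h5 : (1 + K) * enorm (x' - x) <= (1 + K) * (2 * n.+1%:R * rho) by rewrite ler_pM2l.
  by move: r3; rewrite /Q; clear -up h4 h5; lra.
have g_up a b : Rint01 a -> Rint01 b -> enorm (g b - g a) <= `|b - a| * L.
  move=> Ia Ib; have := chord_le_dM M (g a) (g b).
  by rewrite (gd _ _ Ia Ib) lee_fin distrC.
have I0 : Rint01 (0 : R) by rewrite /Rint01/= lexx ler01.
(* [g] stays within [L] of [x], so the local bound of [dM] by chords holds for all chords of [g]. *)
have gnear a : Rint01 a -> `|g a - xb| < rho2.
  move=> Ia; have [a0 a1] := andP Ia.
  have := g_up _ _ I0 Ia; rewrite g0 subr0 ger0_norm// => h1.
  have := norm_le_enorm (g a - x).
  have := ler_distD x (g a) xb.
  have : a * L <= L by rewrite ler_piMl.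
  clear -h1 hx r2 Lmax2 LLmax; lra.
have g_lo a b : Rint01 a -> Rint01 b ->
    `|b - a| * L <= enorm (g b - g a) + K * enorm (g b - g a) ^+ 2.
  move=> Ia Ib; have := HdM _ _ (gM _ Ia) (gM _ Ib) (gnear _ Ia) (gnear _ Ib).
  by rewrite (gd _ _ Ia Ib) lee_fin distrC.
have betaK : 2 * K * L <= beta ^+ 2.
  by apply: le_trans Lmax3; rewrite ler_pM2l// mulr_gt0.
have wE := averaging_deriv_close L0 (ltW K0) (ltW beta0) betaK g_up g_lo It gw.
rewrite g0 g1 in wE.
have gE : enorm ('D_1 gam t - (x' - x)) <= eps / 2 * L.
  rewrite (le_trans (enorm_le_norm _))//.
  apply: (@le_trans _ _ (n.+1%:R * (eps1 * L))).
    apply: ler_pM => //; first by rewrite ler_nat.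
    rewrite (le_trans (gamD _ It))// ler_pM2l//.
    exact: le_trans (norm_le_enorm _) lo.
  suff -> : n.+1%:R * (eps1 * L) = eps / 2 * L by [].
  by rewrite /eps1; field; rewrite gt_eqF.
have := enorm_triangle ('D_1 gam t) (x' - x) w.
rewrite [enorm (x' - x - w)]enorm_dist_sym.
by move: wE; rewrite /beta; clear -gE; lra.
Qed.
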